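(* Let $k$ be a field and $B=k\langle X_+\mid R\rangle$, where $R=\{u-f_u\mid u\in\Lambda\}$ is a minimal Gröbner-Shirshov basis for $B$ with respect to the deg-lex order on $X^+$, $u$ being the leading word of $h_u=u-f_u$ in $k\langle X_+\rangle$. Let $M$ be a $k$-vector space regarded as an algebra with $M^2=0$, let $M$ be a $B$-bimodule, let $\{m_j\}_{j\in J}$ be a $k$-basis of $M$, and let $\{(u)\mid u\in\Lambda\}$ be a family of elements of $M$. Let $$A=k\langle(\{m_j\}_{j\in J}\cup X)_+\mid S_1\rangle,$$ where $S_1$ consists of the relations $$u=f_u+(u),\quad xm_j=[xm_j],\quad m_jx=[m_jx],\quad m_jm_l=0\qquad(u\in\Lambda,\ x\in X,\ j,l\in J).$$ Then $S_1$ is a Gröbner-Shirshov basis for $A$ (with respect to the deg-lex order on $(\{m_j\}_J\cup X)^+$ extending that on $X^+$ with $x>m_j$ for all $x\in X$, $j\in J$) if and only if $$g_{(u_1,u_2)_w}=0\ \text{ in } M\quad\text{for every composition } (h_{u_1},h_{u_2})_w \text{ in } R.$$ Moreover, if this is the case, $A$ is an extension of $M$ by $B$ in a natural way: the linear map $M\to A$, $m_j\mapsto m_j$, is injective, its image is an ideal of $A$ of square zero, and $x\mapsto x+M$ $(x\in X)$ induces an algebra isomorphism $B\cong A/M$.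
   Context: All algebras are associative over the field $k$ and need not have an identity. A $B$-bimodule is a $k$-vector space $M$ with $k$-bilinear left and right actions of $B$ satisfying $(bb')m=b(b'm)$, $m(bb')=(mb)b'$, $(bm)b'=b(mb')$. For a set $Y$, $Y^*$ is the set of all words on $Y$, $Y^+$ the set of nonempty words, $k\langle Y_+\rangle$ the free associative $k$-algebra without identity on $Y$ (the $k$-span of $Y^+$), and $k\langle Y_+\mid S\rangle$ its quotient by the ideal generated by $S$; a relation $u=v$ stands for the polynomial $u-v$. Gröbner-Shirshov bases. Let $Y$ be well ordered. The deg-lex order compares words first by length, then lexicographically. $\bar f$ denotes the leading (largest) word of $f\neq 0$; $f$ is monic if $\bar f$ has coefficient $1$. For monic $f,g$: if $w=\bar fb=a\bar g$ with $a,b\in Y^*$ and $\deg\bar f+\deg\bar g>\deg w$, then $(f,g)_w=fb-ag$ (intersection composition); if $w=\bar f=a\bar gb$ with $a,b\in Y^*$, then $(f,g)_w=f-agb$ (inclusion composition). A composition $(f,g)_w$ is trivial modulo a set $S$ of monic polynomials if $(f,g)_w=\sum\alpha_ia_is_ib_i$ with $\alpha_i\in k$, $a_i,b_i\in Y^*$, $s_i\in S$ and $\overline{a_is_ib_i}<w$ for all $i$. $S$ is a Gröbner-Shirshov basis if every composition of elements of $S$ is trivial modulo $S$. It is minimal if no leading word of an element of $S$ is a subword of the leading word of another element (in particular, the leading words are pairwise different). Here $X$ and $\{m_j\}_J$ are well ordered. $[xm_j]$ and $[m_jx]$ denote the results of the left and right actions on $m_j$ of the class of $x$ in $B$, written as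 linear combinations of the generators $m_j$; $(u)\in M$ is likewise written as a linear combination of the $m_j$. Words of $X^*$ act on $M$ through their classes in $B$, the empty word acting as the identity. The elements $g_{(u_1,u_2)_w}$. Since $R$ is minimal, the compositions in $R$ are intersection ones: $w=u_1c=du_2$ with $u_1,u_2\in\Lambda$, $c,d\in X^+$, $\deg u_1+\deg u_2>\deg w$. As $R$ is a Gröbner-Shirshov basis, one can write in $k\langle X_+\rangle$ $$(h_{u_1},h_{u_2})_w=df_{u_2}-f_{u_1}c=\sum_i\alpha_ia_i(u_i'-f_{u_i'})b_i,$$ with $\alpha_i\in k$, $a_i,b_i\in X^*$, $u_i'\in\Lambda$, $a_iu_i'b_i<w$. Fix one such expression for each composition and put $$g_{(u_1,u_2)_w}=\sum_i\alpha_ia_i(u_i')b_i-\big((u_1)c-d(u_2)\big)\in M,$$ computed with the bimodule actions. An algebra $\mathcal{R}$ is an extension of $M$ by $B$ if $M^2=0$, $M$ is an ideal of $\mathcal{R}$ and $\mathcal{R}/M\cong B$ as algebras. *)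

(* Defs.v *)
From HB Require Import structures.
From mathcomp Require Import all_boot all_order all_algebra.
From mathcomp Require Import finmap.
From mathcomp Require Import boolp classical_sets wochoice.
From mathcomp Require Import generic_quotient ring_quotient.
From mathcomp Require Import monalg.

Set Implicit Arguments.
Unset Strict Implicit.
Unset Printing Implicit Defensive.

Import Order.TTheory GRing.Theory.

Local Open Scope classical_set_scope.
Local Open Scope ring_scope.

Notation "1" := (@mone _) : monom_scope.
Notation "u * v" := (mmul u v) : monom_scope.

HB.mixin Record Lmodule_isNuAlgebra (k : fieldType) A of GRing.Lmodule k A := {
  numul : A -> A -> A;
  numulA : associative numul;
  numulDl : left_distributive numul +%R;
  numulDr : right_distributive numul +%R;
  numulZl : forall (a : k) (x y : A), numul (a *: x) y = a *: numul x y;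
  numulZr : forall (a : k) (x y : A), numul x (a *: y) = a *: numul x y
}.

#[short(type="nuAlgType")]
HB.structure Definition NuAlgebra (k : fieldType) :=
  {A of Lmodule_isNuAlgebra k A & GRing.Lmodule k A}.

Notation "x ** y" := (numul x y) (at level 40, left associativity) : ring_scope.

Section NuAlgebraTheory.
Variables (k : fieldType) (A : nuAlgType k).
Implicit Types (x y : A) (S I : set A).

Record is_ideal I : Prop := {
  ideal0 : I 0;
  idealD : forall x y, I x -> I y -> I (x + y);
  idealZ : forall (a : k) x, I x -> I (a *: x);
  idealMl : forall x y, I y -> I (x ** y);
  idealMr : forall x y, I x -> I (x ** y)
}.

Definition ideal_gen S : set A :=
  [set x | forall I, is_ideal I -> S `<=` I -> I x].

Lemma ideal_gen_ideal S : is_ideal (ideal_gen S).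
Proof.
split=> [I II _|x y Sx Sy I II SI|a x Sx I II SI|x y Sy I II SI|x y Sx I II SI].
- exact: ideal0 II.
- by apply: (idealD II); [apply: Sx|apply: Sy].
- by apply: (idealZ II); apply: Sx.
- by apply: (idealMl II); apply: Sy.
- by apply: (idealMr II); apply: Sx.
Qed.

Definition ideal_genb S : {pred A} := fun x => `[< ideal_gen S x >].

Lemma ideal_genP S x : reflect (ideal_gen S x) (x \in ideal_genb S).
Proof. exact: asboolP. Qed.

Lemma ideal_genb_zmod S : zmod_closed (ideal_genb S).
Proof.
have II := ideal_gen_ideal S.
split=> [|x y /ideal_genP Sx /ideal_genP Sy]; apply/ideal_genP.
  exact: ideal0 II.
by apply: (idealD II) => //; rewrite -scaleN1r; apply: (idealZ II).
Qed.

HB.instance Definition _ S :=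
  GRing.isZmodClosed.Build A (ideal_genb S) (ideal_genb_zmod S).

(** The quotient of [A] by the ideal generated by [S]. *)
Definition nuquot S := Quotient.quot (ideal_genb S : zmodClosed A).

HB.instance Definition _ S := GRing.Zmodule.on (nuquot S).

Definition nuclass S (x : A) : nuquot S :=
  (\pi_(Quotient.quot (ideal_genb S : zmodClosed A)) x)%qT.

End NuAlgebraTheory.

Section NuQuotient.
Variables (k : fieldType) (A : nuAlgType k) (S : set A).
Local Notation Q := (nuquot S).
Local Notation cl := (nuclass S).

Lemma nuclass_eq (x y : A) : cl x = cl y <-> ideal_gen S (x - y).
Proof.
rewrite /nuclass; split=> [/eqP|H]; first by
  rewrite -(Quotient.idealrBE (ideal_genb S)) => /ideal_genP.
by apply/eqP; rewrite -(Quotient.idealrBE (ideal_genb S)); apply/ideal_genP.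
Qed.

Definition nurepr (q : Q) : A :=
  repr (q : Quotient.quot (ideal_genb S : zmodClosed A)).

Lemma nureprK : cancel nurepr cl.
Proof. by move=> q; rewrite /nuclass /nurepr reprK. Qed.

Lemma nureprP (x : A) : ideal_gen S (nurepr (cl x) - x).
Proof. by apply/nuclass_eq; rewrite nureprK. Qed.

Lemma nuclassD (x y : A) : cl (x + y) = cl x + cl y.
Proof. by rewrite /nuclass raddfD. Qed.

Definition nuquot_scale (a : k) (q : Q) : Q := cl (a *: nurepr q).
Definition nuquot_mul (p q : Q) : Q := cl (nurepr p ** nurepr q).

Let II := ideal_gen_ideal S.

Lemma nuclassZ a (x : A) : nuquot_scale a (cl x) = cl (a *: x).
Proof.
by apply/nuclass_eq; rewrite -scalerBr; apply: (idealZ II); apply: nureprP.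
Qed.

Fact nuquot_scaleA a b q :
  nuquot_scale a (nuquot_scale b q) = nuquot_scale (a * b) q.
Proof. by rewrite -(nureprK q) !nuclassZ scalerA. Qed.
Fact nuquot_scale1 : left_id 1 nuquot_scale.
Proof. by move=> q; rewrite -(nureprK q) !nuclassZ scale1r. Qed.
Fact nuquot_scaleDr : right_distributive nuquot_scale +%R.
Proof.
by move=> a p q; rewrite -(nureprK p) -(nureprK q) -nuclassD !nuclassZ scalerDr
  nuclassD.
Qed.
Fact nuquot_scaleDl q : {morph nuquot_scale^~ q : a b / a + b}.
Proof.
by move=> a b; rewrite -(nureprK q) !nuclassZ scalerDl nuclassD.
Qed.

HB.instance Definition _ := GRing.Zmodule_isLmodule.Build k Q
  nuquot_scaleA nuquot_scale1 nuquot_scaleDr nuquot_scaleDl.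

Lemma nuclassZE a (x : A) : cl (a *: x) = a *: cl x.
Proof. by rewrite -nuclassZ. Qed.

Lemma nuclassM (x y : A) : nuquot_mul (cl x) (cl y) = cl (x ** y).
Proof.
apply/nuclass_eq; set x' := nurepr _; set y' := nurepr _.
have -> : x' ** y' - x ** y = (x' - x) ** y' + x ** (y' - y).
  rewrite numulDl numulDr -!scaleN1r !(numulZl, numulZr) !scaleN1r.
  by rewrite -addrA; congr (_ + _); rewrite addrA addNr add0r.
by apply: (idealD II); [apply: (idealMr II)|apply: (idealMl II)]; apply: nureprP.
Qed.

Fact nuquot_mulA : associative nuquot_mul.
Proof.
by move=> p q r; rewrite -(nureprK p) -(nureprK q) -(nureprK r) !nuclassM numulA.
Qed.
Fact nuquot_mulDl : left_distributive nuquot_mul +%R.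
Proof.
move=> p q r; rewrite -(nureprK p) -(nureprK q) -(nureprK r).
by rewrite -nuclassD !nuclassM numulDl nuclassD.
Qed.
Fact nuquot_mulDr : right_distributive nuquot_mul +%R.
Proof.
move=> p q r; rewrite -(nureprK p) -(nureprK q) -(nureprK r).
by rewrite -nuclassD !nuclassM numulDr nuclassD.
Qed.
Fact nuquot_mulZl a p q : nuquot_mul (a *: p) q = a *: nuquot_mul p q.
Proof.
by rewrite -(nureprK p) -(nureprK q) -nuclassZE !nuclassM numulZl nuclassZE.
Qed.
Fact nuquot_mulZr a p q : nuquot_mul p (a *: q) = a *: nuquot_mul p q.
Proof.
by rewrite -(nureprK p) -(nureprK q) -nuclassZE !nuclassM numulZr nuclassZE.
Qed.

HB.instance Definition _ := Lmodule_isNuAlgebra.Build k Q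
  nuquot_mulA nuquot_mulDl nuquot_mulDr nuquot_mulZl nuquot_mulZr.

End NuQuotient.

Record is_bimodule (k : fieldType) (B : nuAlgType k) (M : lmodType k)
    (lact : B -> M -> M) (ract : M -> B -> M) : Prop := {
  lact_linearl : forall v, linear (lact^~ v);
  lact_linearr : forall b, linear (lact b);
  ract_linearl : forall b, linear (ract^~ b);
  ract_linearr : forall v, linear (ract v);
  lactA : forall b b' v, lact (b ** b') v = lact b (lact b' v);
  ractA : forall v b b', ract v (b ** b') = ract (ract v b) b';
  lract : forall b v b', ract (lact b v) b' = lact b (ract v b')
}.

(** The free algebra without identity [k<Y_+>] is carried by the polynomials of
    the free algebra with identity [{malg k[{fmonom Y}]}] that have no constant
    term. Products with possibly empty words are taken in the latter. *)

Section FreeNuAlgebra.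
Variables (k : fieldType) (Y : choiceType).
Local Notation P := {malg k[{fmonom Y}]}.

Definition noconst : {pred P} := fun p => p@_1%M == 0.

Fact noconst_submod : submod_closed noconst.
Proof.
split=> [|a p q]; rewrite !unfold_in ?mcoeff0 //.
by move=> /eqP p0 /eqP q0; rewrite mcoeffD mcoeffZ p0 q0 mulr0 addr0.
Qed.

HB.instance Definition _ := GRing.isSubmodClosed.Build k P noconst noconst_submod.

Record freenu := FreeNu { freenu_val :> P; _ : freenu_val \in noconst }.

HB.instance Definition _ := [isSub for freenu_val].
HB.instance Definition _ := [Choice of freenu by <:].
HB.instance Definition _ := [SubChoice_isSubLmodule of freenu by <:].

Fact freenu_mul_subproof (p q : freenu) : (p : P) * q \in noconst.
Proof.
rewrite unfold_in rmorphM /=; case: p => p /= /eqP ->.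
by rewrite mul0r.
Qed.

Definition freenu_mul (p q : freenu) := FreeNu (freenu_mul_subproof p q).

Fact freenu_mulA : associative freenu_mul.
Proof. by move=> p q r; apply/val_inj/mulrA. Qed.
Fact freenu_mulDl : left_distributive freenu_mul +%R.
Proof. by move=> p q r; apply/val_inj/mulrDl. Qed.
Fact freenu_mulDr : right_distributive freenu_mul +%R.
Proof. by move=> p q r; apply/val_inj/mulrDr. Qed.
Fact freenu_mulZl (a : k) p q : freenu_mul (a *: p) q = a *: freenu_mul p q.
Proof. by apply/val_inj; rewrite /= scalerAl. Qed.
Fact freenu_mulZr (a : k) p q : freenu_mul p (a *: q) = a *: freenu_mul p q.
Proof.
apply/val_inj/malgP => w /=.
rewrite mcoeffZ (mcoeffMlw w (fsubset_refl _) (msuppZ_le a _)) mcoeffMl mulr_sumr.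
apply: eq_bigr => u _; rewrite mulr_sumr; apply: eq_bigr => v _.
by rewrite mcoeffZ mulrnAr mulrCA.
Qed.

HB.instance Definition _ := Lmodule_isNuAlgebra.Build k freenu
  freenu_mulA freenu_mulDl freenu_mulDr freenu_mulZl freenu_mulZr.

(** Equal to [0] when [w] is empty. *)
Definition word (w : {fmonom Y}) : freenu := insubd (0 : freenu) << w >>.

Definition letter (y : Y) : freenu := word (fmu y).

End FreeNuAlgebra.

Definition freenu_map (k : fieldType) (Y Z : choiceType) (h : Y -> Z)
    (p : freenu k Y) : freenu k Z :=
  \sum_(w <- msupp p) p@_w *: word k (FMonom (map h w)).

Section DegLex.
Variables (d : Order.disp_t) (Y : orderType d).
Implicit Types u v w : {fmonom Y}.

Definition deglex u v :=
  (size u < size v)%N ||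
  ((size u == size v) && ((u : seqlexi Y) <= (v : seqlexi Y))%O).

Fact deglex_refl : reflexive deglex.
Proof. by move=> u; rewrite /deglex eqxx lexx orbT. Qed.

Fact deglex_anti : antisymmetric deglex.
Proof.
move=> u v /andP[]; rewrite /deglex.
case: ltngtP => //= _ uv vu; apply/eqP; rewrite fmP; apply/eqP.
by apply: (@le_anti _ (seqlexi Y)); rewrite uv vu.
Qed.

Fact deglex_trans : transitive deglex.
Proof.
move=> v u w; rewrite /deglex => /orP[uv|/andP[/eqP uv luv]].
  by move=> /orP[/(ltn_trans uv) ->//|/andP[/eqP <- _]]; rewrite uv.
rewrite uv => /orP[->//|/andP[-> /(le_trans luv) ->]].
by rewrite orbT.
Qed.

Fact deglex_total : total deglex.
Proof. by move=> u v; rewrite /deglex; case: ltngtP => //= _; apply: le_total. Qed.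

HB.instance Definition _ :=
  Order.Le_isPOrder.Build d {fmonom Y} deglex_refl deglex_anti deglex_trans.
HB.instance Definition _ :=
  Order.POrder_isTotal.Build d {fmonom Y} deglex_total.

End DegLex.

(** Every element of the right summand is above every element of the left one:
    on the generators [J + X] of [A], this is [x > m_j]. *)

Section SumOrder.
Variables (d1 d2 : Order.disp_t) (T1 : orderType d1) (T2 : orderType d2).

Definition sum_le (x y : T1 + T2) :=
  match x, y with
  | inl a, inl b => (a <= b)%O
  | inl _, inr _ => true
  | inr _, inl _ => false
  | inr a, inr b => (a <= b)%O
  end.

Fact sum_le_refl : reflexive sum_le.
Proof. by case=> a /=. Qed.
Fact sum_le_anti : antisymmetric sum_le.
Proof. by case=> a [] b //= /le_anti ->. Qed.
Fact sum_le_trans : transitive sum_le.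
Proof. by case=> b [] a [] c //=; apply: le_trans. Qed.
Fact sum_le_total : total sum_le.
Proof. by case=> a [] b //=; apply: le_total. Qed.

HB.instance Definition _ :=
  Order.Le_isPOrder.Build d2 (T1 + T2)%type sum_le_refl sum_le_anti sum_le_trans.
HB.instance Definition _ :=
  Order.POrder_isTotal.Build d2 (T1 + T2)%type sum_le_total.

End SumOrder.

Section GroebnerShirshov.
Variables (k : fieldType) (d : Order.disp_t) (Y : orderType d).
Implicit Types (p : {malg k[{fmonom Y}]}) (f g : freenu k Y).
Implicit Types (S : set (freenu k Y)) (a b w : {fmonom Y}).

(** The leading word; the empty word, which is the least one, if [p = 0]. *)
Definition lead p : {fmonom Y} := \big[Order.max/1%M]_(w <- msupp p) w.

Definition is_monic p := p@_(lead p) = 1.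

Definition trivial_mod S w p :=
  exists (n : nat) (alpha : 'I_n -> k) (a b : 'I_n -> {fmonom Y})
         (s : 'I_n -> freenu k Y),
    (forall i, S (s i) /\ (lead (<< a i >> * s i * << b i >>) < w)%O) /\
    p = \sum_(i < n) alpha i *: (<< a i >> * s i * << b i >>).

(** [is_composition f g w p] reads "[p] is a composition [(f, g)_w]": for given
    [f], [g] and [w] there may be several inclusion compositions. *)
Variant is_composition f g w : {malg k[{fmonom Y}]} -> Prop :=
| Intersection a b of w = (lead f * b)%M & w = (a * lead g)%M
    & (size w < size (lead f) + size (lead g))%N :
    is_composition f g w ((f : {malg _[_]}) * << b >> - << a >> * g)
| Inclusion a b of w = lead f & w = (a * lead g * b)%M :
    is_composition f g w ((f : {malg _[_]}) - << a >> * g * << b >>).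

Definition GS_basis S :=
  (forall f, S f -> is_monic f) /\
  (forall f g w p, S f -> S g -> is_composition f g w p -> trivial_mod S w p).

Definition GS_minimal S :=
  forall f g, S f -> S g -> f <> g -> ~~ infix (lead f) (lead g).

End GroebnerShirshov.

Section Basis.
Variables (k : fieldType) (M : lmodType k) (J : choiceType) (m : J -> M).

Definition lincomb (c : {malg k[J]}) : M := \sum_(j <- msupp c) c@_j *: m j.

Definition is_basis := forall v : M, exists! c, lincomb c = v.

(** Meaningful only when [m] is a basis. *)
Definition basis_coord (v : M) : {malg k[J]} := xget 0 [set c | lincomb c = v].

End Basis.

(** An expression [\sum_i alpha_i a_i (u_i - f_{u_i}) b_i]. *)
Record expression (k : fieldType) (X : choiceType) := Expression {
  esize : nat;
  ecoef : 'I_esize -> k;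
  eleft : 'I_esize -> {fmonom X};
  eword : 'I_esize -> {fmonom X};
  eright : 'I_esize -> {fmonom X}
}.

Arguments ecoef {k X} e i : rename.
Arguments eleft {k X} e i : rename.
Arguments eword {k X} e i : rename.
Arguments eright {k X} e i : rename.

Section Extension.
Variables (k : fieldType) (dX dJ : Order.disp_t).
Variables (X : orderType dX) (J : orderType dJ).
(* [f] and the family [mu] below matter only on [Lambda]; [mu u] is [(u)]. *)
Variables (Lambda : set {fmonom X}) (f : {fmonom X} -> freenu k X).
Implicit Types (u c d : {fmonom X}).

Definition hrel u : freenu k X := word k u - f u.

Definition R_rel : set (freenu k X) := [set hrel u | u in Lambda].

Definition algB : nuAlgType k := nuquot R_rel.

(** The composition of [h_u1] and [h_u2] relative to [w = u1 c = d u2]; the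
    words [c] and [d] are determined by [u1], [u2] and [w]. *)
Definition R_composition u1 u2 c d :=
  [/\ Lambda u1, Lambda u2, c != 1%M, d != 1%M &
      (u1 * c)%M = (d * u2)%M /\ (size (u1 * c)%M < size u1 + size u2)%N].

Definition expression_of u1 u2 c d (e : expression k X) :=
  (forall i, Lambda (eword e i) /\
     (eleft e i * eword e i * eright e i < u1 * c)%M%O) /\
  << d >> * f u2 - (f u1 : {malg _[_]}) * << c >> =
    \sum_(i < esize e)
      ecoef e i *: (<< eleft e i >> * hrel (eword e i) * << eright e i >>).

Variables (M : lmodType k) (lact : algB -> M -> M) (ract : M -> algB -> M).
Variables (m : J -> M) (mu : {fmonom X} -> M).

Definition wlact (a : {fmonom X}) (v : M) : M :=
  if a == 1%M then v else lact (nuclass R_rel (word k a)) v.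
Definition wract (v : M) (b : {fmonom X}) : M :=
  if b == 1%M then v else ract v (nuclass R_rel (word k b)).

Definition g_elt u1 u2 c d (e : expression k X) : M :=
  \sum_(i < esize e)
    ecoef e i *: wract (wlact (eleft e i) (mu (eword e i))) (eright e i)
  - (wract (mu u1) c - wlact d (mu u2)).

Local Notation FA := (freenu k (J + X)%type).

Definition m_letter (j : J) : FA := letter k (inl j).
Definition x_letter (x : X) : FA := letter k (inr x).

Definition m_poly (v : M) : FA :=
  \sum_(j <- msupp (basis_coord m v)) (basis_coord m v)@_j *: m_letter j.

Definition S1_rel : set FA :=
  [set p | [\/
    exists2 u, Lambda u &
      p = word k (FMonom (map inr u)) - (freenu_map inr (f u) + m_poly (mu u)),
    exists x j, p = x_letter x ** m_letter j
                  - m_poly (lact (nuclass R_rel (letter k x)) (m j)),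
    exists j x, p = m_letter j ** x_letter x
                  - m_poly (ract (m j) (nuclass R_rel (letter k x)))
  | exists j l, p = m_letter j ** m_letter l]].

Definition algA : nuAlgType k := nuquot S1_rel.

End Extension.

(* Main.v *)
(** Call value of a word containing a letter [m_j] its value in [M]: the result
    of letting the letters from [X] act on [m_j] if there is only one such
    letter, and [0] if there are several. Any two adjacent letters one of which
    is some [m_j] form the leading word of a relation of [S_1], so a word of this
    kind is congruent to its value modulo [S_1], using smaller words only. The
    value of [a s b], for [s] in [S_1], is [0] as soon as its leading word
    contains some [m_j], by the bimodule axioms; hence all compositions in [S_1]
    with such a [w] are trivial, without a case analysis. For the other [w], the
    composition lies over a composition in [R], and reduces to
    [g_(u1, u2)_w]. By the composition-diamond lemma a nonzero element of [M]
    does not lie in the ideal generated by a Groebner-Shirshov basis [S_1], which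
    gives the converse and the injectivity of [M -> A]. *)

Require Import Defs.
From HB Require Import structures.
From mathcomp Require Import all_boot all_order all_algebra.
From mathcomp Require Import finmap.
From mathcomp Require Import boolp classical_sets wochoice.
From mathcomp Require Import monalg.

Set Implicit Arguments.
Unset Strict Implicit.
Unset Printing Implicit Defensive.

Import Order.TTheory GRing.Theory.

Local Open Scope classical_set_scope.
Local Open Scope ring_scope.

(** * Linear extension and monoid algebras *)

(** The value of a word is not an invariant of its class in [A]: words over [X] get the value 0, so
    the relation [u = f_u + (u)] has value [- (u)]. One therefore cannot argue with a map from [A]
    to [M]; values are compared only on polynomials all of whose words contain some [m_j], and the
    independence of the [m_j] in [A] has to come from leading words. Triviality of a composition is
    also finer than membership in the ideal, since every multiple used must stay below [w]. Hence
    [spanned] carries a predicate on leading words: [v < w] for triviality, [True] for the ideal.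
    The shape of [g] comes from completing each [h_u'] in the fixed expression to the relation
    [u' - f_u' - (u')]: this costs [(u')] in place of [h_u'], and the two relations that are
    composed contribute [- ((u1) c - d (u2))]. Minimality of [R] enters for compositions over [X] in
    which one leading word contains the other: they compose a relation with itself and vanish. *)

Section LinearExtension.
Variables (k : fieldType) (K : choiceType) (V : lmodType k) (h : K -> V).
Implicit Types (p : {malg k[K]}).

(** The body is that of [lincomb], [m_poly] and [freenu_map] for an arbitrary family, so these fold
    into [lext] and inherit its linearity. *)
Definition lext p : V := \sum_(j <- msupp p) p@_j *: h j.

Lemma lextEw (D : {fset K}) p : (msupp p `<=` D)%fset ->
  lext p = \sum_(j <- D) p@_j *: h j.
Proof.
move=> le; rewrite [LHS](big_fset_incl _ le) => //= x xD /mcoeff_outdom ->.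
by rewrite scale0r.
Qed.

Fact lext_linear : linear lext.
Proof.
move=> a p q; pose D := (msupp p `|` msupp q)%fset.
have pD : (msupp p `<=` D)%fset by apply: fsubsetUl.
have qD : (msupp q `<=` D)%fset by apply: fsubsetUr.
have apq : (msupp (a *: p + q) `<=` D)%fset.
  by apply: (fsubset_trans (msuppD_le _ _)); apply: fsetSU; apply: msuppZ_le.
rewrite (lextEw pD) (lextEw qD) (lextEw apq) scaler_sumr -big_split /=.
by apply: eq_bigr => j _; rewrite mcoeffD mcoeffZ scalerDl scalerA.
Qed.

HB.instance Definition _ :=
  GRing.isLinear.Build k {malg k[K]} V *:%R lext lext_linear.

Lemma lextU j : lext << j >> = h j.
Proof. by rewrite (lextEw msuppU_le) big_seq_fset1 mcoeffUU scale1r. Qed.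

End LinearExtension.

Section MonoidAlgebra.
Variables (k : fieldType) (K : choiceType).
Implicit Types (p q : {malg k[K]}).

Lemma malg_lin p : p = \sum_(j <- msupp p) p@_j *: << j >>.
Proof.
rewrite {1}[p]monalgE; apply: eq_bigr => j _; apply/malgP => i.
by rewrite mcoeffZ !mcoeffU mulrnAr mulr1.
Qed.

Lemma malg_linear_eq (V : lmodType k) (F G : {linear {malg k[K]} -> V}) :
  (forall j, F << j >> = G << j >>) -> F =1 G.
Proof.
move=> FG p; rewrite [p]malg_lin !linear_sum.
by apply: eq_bigr => j _; rewrite !linearZ FG.
Qed.

Lemma lext_eq (V : lmodType k) (h h' : K -> V) p :
  (forall j, j \in msupp p -> h j = h' j) -> lext h p = lext h' p.
Proof.
move=> hh'; rewrite /lext big_seq [RHS]big_seq.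
by apply: eq_bigr => j /hh' ->.
Qed.

Lemma linear_lext (V W : lmodType k) (F : {linear V -> W}) (h : K -> V) p :
  F (lext h p) = lext (F \o h) p.
Proof.
by rewrite /lext linear_sum; apply: eq_bigr => j _; rewrite linearZ.
Qed.

Lemma lextB (V : lmodType k) (h h' : K -> V) p :
  lext (fun j => h j - h' j) p = lext h p - lext h' p.
Proof. by rewrite /lext -sumrB; apply: eq_bigr => j _; rewrite scalerBr. Qed.

Lemma lext_id p : lext (fun j => << j >>) p = p.
Proof. by rewrite [RHS]malg_lin. Qed.

Lemma msupp_lext (L : choiceType) (h : L -> {malg k[K]}) (p : {malg k[L]}) w :
  w \in msupp (lext h p) -> exists2 j, j \in msupp p & w \in msupp (h j).
Proof.
rewrite -mcoeff_neq0 /lext raddf_sum /= => /eqP H.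
apply: contrapT => nex; apply: H; rewrite big_seq big1 // => j jp.
rewrite mcoeffZ; case: (boolP (w \in msupp (h j))) => [wj|]; last first.
  by rewrite -mcoeff_eq0 => /eqP ->; rewrite mulr0.
by case: nex; exists j.
Qed.

End MonoidAlgebra.

(* Locked, since unification would otherwise unfold the products of
   [{malg k[K]}] into sums. *)
HB.lock Definition sandwich (k : fieldType) (K : monomType) (a b : K)
  (p : {malg k[K]}) : {malg k[K]} := << a >> * p * << b >>.

Section Sandwich.
Variables (k : fieldType) (K : monomType).
Implicit Types (p q : {malg k[K]}) (a b : K).

Lemma malg_scalerAr (c : k) p q : p * (c *: q) = c *: (p * q).
Proof.
apply/malgP => w.
rewrite mcoeffZ (mcoeffMlw w (fsubset_refl _) (msuppZ_le c _)) mcoeffMl mulr_sumr.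
apply: eq_bigr => u _; rewrite mulr_sumr; apply: eq_bigr => v _.
by rewrite mcoeffZ mulrnAr mulrCA.
Qed.

Lemma sandwichM a b p : sandwich a b p = << a >> * p * << b >>.
Proof. by rewrite sandwich.unlock. Qed.

Fact sandwich_linear a b : linear (@sandwich k K a b).
Proof.
move=> c p q.
by rewrite !sandwichM mulrDr mulrDl malg_scalerAr -scalerAl.
Qed.

HB.instance Definition _ a b :=
  GRing.isLinear.Build k {malg k[K]} {malg k[K]} *:%R (@sandwich k K a b)
    (sandwich_linear a b).

Lemma malgUM a b : << a >> * << b >> = << (a * b)%M >> :> {malg k[K]}.
Proof. by rewrite malgM_def fgmulUU mulr1. Qed.

Lemma sandwichU a b w : sandwich a b << w >> = << (a * w * b)%M >> :> {malg k[K]}.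
Proof. by rewrite !sandwichM !malgUM. Qed.

Lemma sandwichE a b p : sandwich a b p = lext (fun w => << (a * w * b)%M >>) p.
Proof.
apply: (malg_linear_eq (F := @sandwich k K a b) (G := lext _)) => w.
by rewrite /= sandwichU lextU.
Qed.

Lemma lext_sandwich (V : lmodType k) (h : K -> V) a b p :
  lext h (sandwich a b p) = lext (fun w => h (a * w * b)%M) p.
Proof.
by rewrite sandwichE linear_lext; apply: lext_eq => w _ /=; rewrite lextU.
Qed.

Lemma sandwich_comp a b a' b' p :
  sandwich a b (sandwich a' b' p) = sandwich (a * a')%M (b' * b)%M p.
Proof. by rewrite !sandwichM -!malgUM !mulrA. Qed.

Lemma sandwich1 p : sandwich 1%M 1%M p = p.
Proof. by rewrite !sandwichM mul1r mulr1. Qed.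

Lemma sandwichl a p : sandwich a 1%M p = << a >> * p.
Proof. by rewrite !sandwichM mulr1. Qed.

Lemma sandwichr b p : sandwich 1%M b p = p * << b >>.
Proof. by rewrite !sandwichM mul1r. Qed.

Lemma msupp_sandwich a b p w : w \in msupp (sandwich a b p) ->
  exists2 v, v \in msupp p & w = (a * v * b)%M.
Proof.
rewrite sandwichE => /msupp_lext[v vp]; rewrite msuppU oner_eq0 inE => /eqP.
by exists v.
Qed.

End Sandwich.

(** * The deg-lex order and leading words *)

Section FmonomFacts.
Variables (Y : choiceType).
Implicit Types (a b u v w : {fmonom Y}).

Lemma fmonom_inj u v : (u : seq Y) = v -> u = v.
Proof. by move=> uv; apply/eqP; rewrite fmP uv. Qed.

Lemma fmonom_mulKl a : injective (mmul a).
Proof.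
move=> u v /(congr1 (@fmonom_val Y)); rewrite !fmM => /eqP.
by rewrite eqseq_cat // eqxx => /eqP /fmonom_inj.
Qed.

(** Levi's lemma for the free monoid. It turns an equality of two factorised words into the relative
    position of the factors. *)
Lemma fmonom_catI a1 b1 a2 b2 : (a1 * b1)%M = (a2 * b2)%M ->
  (size a1 <= size a2)%N -> exists c, a2 = (a1 * c)%M /\ b1 = (c * b2)%M.
Proof.
move=> /(congr1 (@fmonom_val Y)); rewrite !fmM => e le.
have a1E : (a1 : seq Y) = take (size a1) a2.
  by rewrite -(takel_cat b2 le) -e take_size_cat.
exists (FMonom (drop (size a1) a2)).
have a2E : a2 = (a1 * FMonom (drop (size a1) a2))%M.
  by apply: fmonom_inj; rewrite fmM /= {1}a1E cat_take_drop.
split=> //; apply: (@fmonom_mulKl a1); rewrite mulmA -a2E.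
by apply: fmonom_inj; rewrite !fmM.
Qed.

Lemma size_fmonom1 a : size a = 0%N -> a = 1%M.
Proof. by move=> /size0nil a0; apply: fmonom_inj; rewrite fm1. Qed.

End FmonomFacts.

Section DegLexFacts.
Variables (d : Order.disp_t) (Y : orderType d).
Implicit Types (a b u v w : {fmonom Y}).

Lemma deglex_ltE u v : (u < v)%O =
  (size u < size v)%N || ((size u == size v) && ((u : seqlexi Y) < v)%O).
Proof.
have leE x y : (x <= y)%O = deglex x y by [].
rewrite ltNge leE /deglex negb_or negb_and -ltNge -leqNgt eq_sym.
by case: ltngtP.
Qed.

(** Equal lengths matter: a proper prefix is lexicographically smaller, and appending [b] can
    reverse that. *)
Lemma ltxi_sandwich (a b s t : seq Y) : size s = size t ->
  ((s : seqlexi Y) < t)%O ->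
  ((a ++ s ++ b : seqlexi Y) < a ++ t ++ b)%O.
Proof.
move=> st lt; elim: a => [|x a IH] /=; last by rewrite ltxi_cons lexx IH.
elim: s t st lt => [|x s IH] [|y t] //= [st]; rewrite !ltxi_cons.
by case: (ltgtP x y) => //= _ /(IH _ st).
Qed.

Lemma deglex_lt_mul a b u v : (u < v)%O -> (a * u * b < a * v * b)%M%O.
Proof.
rewrite !deglex_ltE !fmM !size_cat !ltn_add2r !ltn_add2l !eqn_add2r !eqn_add2l.
case/orP=> [->//|/andP[/eqP uv lt]].
by rewrite uv eqxx -!catA ltxi_sandwich ?orbT.
Qed.

Lemma deglex_size_lt u v : (size u < size v)%N -> (u < v)%O.
Proof. by rewrite deglex_ltE => ->. Qed.

Lemma deglex_ge1 u : ((1%M : {fmonom Y}) <= u)%O.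
Proof.
rewrite leNgt; apply/negP; rewrite deglex_ltE fm1.
move=> /orP[//|/andP[/eqP /size0nil ->]].
by rewrite ltxx.
Qed.

Hypothesis Y_wo : well_order (<=%O : rel Y).

Lemma well_order_ind (P : Y -> Prop) :
  (forall x, (forall y, (y < x)%O -> P y) -> P x) -> forall x, P x.
Proof.
move=> Pind x; apply: contrapT => nPx.
have [|z [[Az zmin] _]] := Y_wo (A := [pred y | `[< ~ P y >]]).
  by exists x; apply/asboolP.
move/asboolP: Az; apply; apply: Pind => y yz; apply: contrapT => nPy.
by have := zmin y; rewrite leNgt yz => /(_ _)/negP; apply => //; apply/asboolP.
Qed.

(** The length is fixed because the lexicographic order on all words is not well founded: for
    [y < z] the words [z], [yz], [yyz], ... descend forever. At length [n] the induction is on the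
    first letter, then on the tail. *)
Lemma ltxi_ind n (P : seq Y -> Prop) :
  (forall s, size s = n ->
    (forall t, size t = n -> ((t : seqlexi Y) < s)%O -> P t) -> P s) ->
  forall s, size s = n -> P s.
Proof.
elim: n P => [|n IH] P Pind s.
  by move=> s0; apply: Pind => // t _; rewrite (size0nil s0) ltxis0.
case: s => // x s [sn]; move: x s sn; apply: well_order_ind => x IHx.
apply: IH => s sn IHs; apply: Pind => /=; first by rewrite sn.
case=> // y t [tn]; rewrite ltxi_cons.
case: (ltgtP y x) => //= [yx _|-> /IHs]; last exact.
exact: IHx.
Qed.

Lemma deglex_ind (P : {fmonom Y} -> Prop) :
  (forall w, (forall v, (v < w)%O -> P v) -> P w) -> forall w, P w.
Proof.
move=> Pind w; have [n] := ubnP (size w); elim: n w => // n IH w.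
rewrite ltnS leq_eqVlt => /orP[/eqP|]; last exact: IH.
pose Q (s : seq Y) := P (FMonom s).
suff H : forall s : seq Y, size s = n -> Q s.
  by move=> /H; rewrite /Q fmK.
apply: ltxi_ind => s sn IHs; apply: Pind => v.
rewrite deglex_ltE => /orP[/=|/andP[/eqP /= vs lt]]; first by rewrite sn; apply: IH.
by rewrite -(fmK v); apply: IHs; rewrite // vs.
Qed.

End DegLexFacts.

Section Leading.
Variables (k : fieldType) (d : Order.disp_t) (Y : orderType d).
Local Notation P := {malg k[{fmonom Y}]}.
Implicit Types (p q : P) (a b u v w : {fmonom Y}).

(** Bounding the support instead of [lead p] gives a condition closed under linear combinations,
    with no case distinction when leading terms cancel or the polynomial vanishes. *)
Definition below w p := forall v, v \in msupp p -> (v < w)%O.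

Lemma below0 w : below w 0.
Proof. by move=> v; rewrite msupp0. Qed.

Lemma belowD w p q : below w p -> below w q -> below w (p + q).
Proof.
move=> bp bq v /(fsubsetP (msuppD_le p q)).
by rewrite in_fsetU => /orP[/bp|/bq].
Qed.

Lemma belowZ w c p : below w p -> below w (c *: p).
Proof. by move=> bp v /(fsubsetP (msuppZ_le c p)) /bp. Qed.

Lemma belowN w p : below w p -> below w (- p).
Proof. by rewrite -scaleN1r; apply: belowZ. Qed.

Lemma belowB w p q : below w p -> below w q -> below w (p - q).
Proof. by move=> bp /belowN; apply: belowD. Qed.

Lemma belowU v w : (v < w)%O -> below w << v >>.
Proof. by move=> vw x; rewrite msuppU oner_eq0 inE => /eqP ->. Qed.

Lemma below_lext (K : choiceType) (h : K -> P) (c : {malg k[K]}) w :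
  (forall j, j \in msupp c -> below w (h j)) -> below w (lext h c).
Proof. by move=> bh v /msupp_lext[j jc]; apply: bh. Qed.

Lemma below_sandwich w a b p : below w p -> below (a * w * b)%M (sandwich a b p).
Proof.
by move=> bp v /msupp_sandwich[u /bp uw ->]; apply: deglex_lt_mul.
Qed.

Lemma below_trans w w' p : (w <= w')%O -> below w p -> below w' p.
Proof. by move=> ww' bp v /bp /lt_le_trans; apply. Qed.

Lemma lead_max p v : v \in msupp p -> (v <= lead p)%O.
Proof.
rewrite /lead -[v \in _]/(v \in enum_fset (msupp p)).
elim: (enum_fset _) => // u s IH; rewrite inE big_cons le_max.
move=> /orP[/eqP ->|/IH ->]; first by rewrite lexx.
by rewrite orbT.
Qed.

Lemma lead_in p : lead p = 1%M \/ lead p \in msupp p.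
Proof.
rewrite -[_ \in _]/(lead p \in enum_fset (msupp p)) /lead.
elim: (enum_fset _) => [|u s IH]; first by left; rewrite big_nil.
rewrite big_cons /Order.max; case: ifP => _; last by right; rewrite mem_head.
by case: IH => [|H]; [left|right; rewrite inE H orbT].
Qed.

Lemma below_lead w p : below w (p - << w >>) -> lead p = w /\ is_monic p.
Proof.
move=> bp; have pw : p@_w = 1.
  apply/eqP; rewrite -subr_eq0; apply/eqP.
  case: msuppP (mcoeffB w p << w >>) => [/bp|_]; first by rewrite ltxx.
  by rewrite mcoeffUU.
have wp : w \in msupp p by rewrite -mcoeff_neq0 pw oner_neq0.
suff leadE : lead p = w by rewrite /is_monic leadE.
apply: le_anti; rewrite (lead_max wp) andbT.
case: (lead_in p) => [->|]; first exact: deglex_ge1.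
have [->//|nw] := eqVneq (lead p) w => lp; apply/ltW/bp.
by rewrite -mcoeff_neq0 mcoeffB mcoeffU (eq_sym w) (negPf nw) subr0 mcoeff_neq0.
Qed.

Lemma lead_below p : is_monic p -> below (lead p) (p - << lead p >>).
Proof.
move=> mp v; have [->|nv] := eqVneq v (lead p).
  by rewrite -mcoeff_neq0 mcoeffB mp mcoeffUU subrr eqxx.
rewrite -mcoeff_neq0 mcoeffB mcoeffU (eq_sym (lead p)) (negPf nv) subr0 mcoeff_neq0.
by rewrite lt_neqAle nv; apply: lead_max.
Qed.

Lemma lead_sandwich a b p : is_monic p ->
  lead (sandwich a b p) = (a * lead p * b)%M.
Proof.
move=> /lead_below /(@below_sandwich _ a b _); rewrite linearB /= sandwichU.
by case/below_lead.
Qed.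

Lemma lead_neq0 p : p != 0 -> lead p \in msupp p.
Proof.
case: (lead_in p) => // p1 nz; rewrite p1.
have /fset0Pn[v vp] : msupp p != fset0 by rewrite msupp_eq0.
have := lead_max vp; rewrite p1 => v1; suff <- : v = 1%M by [].
by apply: le_anti; rewrite v1 deglex_ge1.
Qed.

End Leading.

(** * The composition-diamond lemma *)

(** For [u1], [u2] the leading words of [s1], [s2], this settles disjoint occurrences: the
    right-hand side consists of multiples of [s1] and [s2] in which a leading word was replaced by
    smaller words. *)
Fact overlap_identity (R : pzRingType) (s1 s2 u1 u2 x b : R) :
  s1 * (x * (u2 * b)) - u1 * x * s2 * b =
  s1 * (x * (u2 - s2) * b) + (s1 - u1) * x * s2 * b.
Proof.
by rewrite mulrBr !mulrBl mulrBr !mulrA addrA subrK.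
Qed.

(** For [v1], [v2] multiples of relations with the same leading word, [v1 - v2] is a remainder of
    smaller multiples, so two top summands merge into one. *)
Fact merge_identity (R : pzRingType) (V : lmodType R) (c1 c2 : R)
    (v1 v2 q1 q2 : V) :
  c1 *: v1 + q1 + (c2 *: v2 + q2) =
  (c1 + c2) *: v1 + (q1 + q2 - c2 *: (v1 - v2)).
Proof.
rewrite scalerDl scalerBr opprB (addrC (q1 + q2)) [RHS]addrA.
by rewrite (addrC (c2 *: v2) (- _)) [X in _ = X + _]addrA addrK addrACA.
Qed.

(* In the intersection case the last component says that the two leading words
   overlap properly; in the inclusion case [b = 1]. *)
Lemma is_composition_sandwich (k : fieldType) (d : Order.disp_t)
    (Y : orderType d) (s t : freenu k Y) (w : {fmonom Y}) p :
  is_composition s t w p -> exists a b b' : {fmonom Y},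
    [/\ p = sandwich 1%M b s - sandwich a b' t,
        w = (1 * lead s * b)%M, w = (a * lead t * b')%M &
        (b = 1%M) \/ (b' = 1%M /\ (size w < size (lead s) + size (lead t))%N)].
Proof.
case=> [a b -> e sz|a b -> e].
  exists a, b, 1%M; rewrite mul1m mulm1; split=> //; last by right.
  by rewrite sandwichr sandwichl.
exists a, 1%M, b; rewrite mul1m mulm1; split=> //; last by left.
by rewrite sandwich1 sandwichM.
Qed.

(** * Spans of multiples of relations with prescribed leading words *)

Section Span.
Variables (k : fieldType) (d : Order.disp_t) (Y : orderType d).
Variable (S : set (freenu k Y)).
Local Notation P := {malg k[{fmonom Y}]}.
Implicit Types (p q : P) (s : freenu k Y) (a b u v w : {fmonom Y}).
Implicit Types (Q : {fmonom Y} -> Prop).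

(* [trivial_mod S w] is the case [Q v := v < w]. *)
Definition spanned Q p :=
  exists (n : nat) (alpha : 'I_n -> k) (a b : 'I_n -> {fmonom Y})
         (s : 'I_n -> freenu k Y),
    (forall i, S (s i) /\ Q (lead (<< a i >> * s i * << b i >>))) /\
    p = \sum_(i < n) alpha i *: (<< a i >> * s i * << b i >>).

Lemma trivial_modE w p : trivial_mod S w p = spanned (fun v => (v < w)%O) p.
Proof. by []. Qed.

Lemma spanned0 Q : spanned Q 0.
Proof.
exists 0%N, (fun _ => 0), (fun _ => 1%M), (fun _ => 1%M), (fun _ => 0).
by split; [case|rewrite big_ord0].
Qed.

Lemma spannedD Q p q : spanned Q p -> spanned Q q -> spanned Q (p + q).
Proof.
move=> [n [al [a [b [s [H ->]]]]]] [n' [al' [a' [b' [s' [H' ->]]]]]].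
pose join T (g : 'I_n -> T) (g' : 'I_n' -> T) (i : 'I_(n + n')) :=
  match split i with inl j => g j | inr j => g' j end.
exists (n + n')%N, (join _ al al'), (join _ a a'), (join _ b b'), (join _ s s').
split; first by move=> i; rewrite /join; case: split.
have joinl T g g' i : join T g g' (lshift n' i) = g i.
  by rewrite /join (unsplitK (inl i)).
have joinr T g g' i : join T g g' (rshift n i) = g' i.
  by rewrite /join (unsplitK (inr i)).
rewrite big_split_ord; apply: (f_equal2 +%R); apply: eq_bigr => i _.
  by rewrite !joinl.
by rewrite !joinr.
Qed.

Lemma spannedZ Q c p : spanned Q p -> spanned Q (c *: p).
Proof.
move=> [n [al [a [b [s [H ->]]]]]].
exists n, (fun i => c * al i), a, b, s; split=> //.
by rewrite scaler_sumr; apply: eq_bigr => i _; rewrite scalerA.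
Qed.

Lemma spannedN Q p : spanned Q p -> spanned Q (- p).
Proof. by rewrite -scaleN1r; apply: spannedZ. Qed.

Lemma spannedB Q p q : spanned Q p -> spanned Q q -> spanned Q (p - q).
Proof. by move=> sp /spannedN; apply: spannedD. Qed.

Lemma spanned_sandwich_gen Q a b s : S s -> Q (lead (sandwich a b s)) ->
  spanned Q (sandwich a b s).
Proof.
move=> Ss Qs; exists 1%N, (fun _ => 1), (fun _ => a), (fun _ => b), (fun _ => s).
by rewrite -sandwichM; split=> //; rewrite big_ord1 scale1r.
Qed.

Lemma spanned_ind Q (F : P -> Prop) : F 0 ->
  (forall p q, F p -> F q -> F (p + q)) ->
  (forall c a b s, S s -> Q (lead (sandwich a b s)) ->
     F (c *: sandwich a b s)) ->
  forall p, spanned Q p -> F p.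
Proof.
move=> F0 FD Fg p [n [al [a [b [s [H ->]]]]]].
apply: (big_ind F) => // i _; have [Ss] := H i.
by rewrite -sandwichM; apply: Fg.
Qed.

Lemma spanned_sum Q I (r : seq I) (G : I -> P) (c : I -> k) :
  (forall i, spanned Q (G i)) -> spanned Q (\sum_(i <- r) c i *: G i).
Proof.
move=> QG; apply: (big_ind (spanned Q)); first exact: spanned0.
  exact: spannedD.
by move=> i _; apply: spannedZ.
Qed.

Lemma spanned_lext Q (K : choiceType) (h : K -> P) (c : {malg k[K]}) :
  (forall j, j \in msupp c -> spanned Q (h j)) -> spanned Q (lext h c).
Proof.
move=> Qh; rewrite /lext big_seq; apply: (big_ind (spanned Q)).
- exact: spanned0.
- exact: spannedD.
- by move=> j jc; apply/spannedZ/Qh.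
Qed.

Hypothesis S_monic : forall s, S s -> is_monic s.

Lemma spanned_gen Q a b s : S s -> Q (a * lead s * b)%M ->
  spanned Q (sandwich a b s).
Proof.
move=> Ss Qs; apply: spanned_sandwich_gen => //.
by rewrite lead_sandwich //; apply: S_monic.
Qed.

Lemma spanned_mulr Q s p : S s ->
  (forall v, v \in msupp p -> Q (lead s * v)%M) -> spanned Q ((s : P) * p).
Proof.
move=> Ss H; rewrite {1}[p]malg_lin mulr_sumr big_seq.
apply: (big_ind (spanned Q)); [exact: spanned0|exact: spannedD|].
move=> v vp; rewrite malg_scalerAr -sandwichr; apply: spannedZ.
by apply: spanned_gen => //; rewrite mul1m; apply: H.
Qed.

Lemma spanned_mull Q s p b : S s ->
  (forall v, v \in msupp p -> Q (v * lead s * b)%M) ->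
  spanned Q (p * (s : P) * << b >>).
Proof.
move=> Ss H; rewrite -sandwichr.
have -> : p * (s : P) = \sum_(v <- msupp p) p@_v *: (<< v >> * (s : P)).
  rewrite {1}[p]malg_lin mulr_suml.
  by apply: eq_bigr => v _; rewrite -scalerAl.
rewrite linear_sum big_seq.
apply: (big_ind (spanned Q)); [exact: spanned0|exact: spannedD|].
move=> v vp; rewrite linearZ /= sandwichr -sandwichM; apply: spannedZ.
by apply: spanned_gen => //; apply: H.
Qed.

Lemma spanned_sandwich Q Q' a b p : (forall v, Q v -> Q' (a * v * b)%M) ->
  spanned Q p -> spanned Q' (sandwich a b p).
Proof.
move=> QQ'; apply: (spanned_ind (F := fun p => spanned Q' (sandwich a b p))).
- by rewrite linear0; apply: spanned0.
- by move=> p1 p2 sp1 sp2; rewrite linearD /=; apply: spannedD.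
move=> c a' b' s Ss; rewrite lead_sandwich; last exact: S_monic.
move=> /QQ' H; rewrite linearZ /=; apply: spannedZ.
rewrite sandwich_comp; apply: spanned_gen => //.
by move: H; rewrite !mulmA.
Qed.

Lemma spannedW Q Q' p : (forall v, Q v -> Q' v) -> spanned Q p -> spanned Q' p.
Proof.
by move=> QQ' [n [al [a [b [s [H ->]]]]]]; exists n, al, a, b, s;
  split=> // i; have [? /QQ'] := H i.
Qed.

Lemma trivial_mod_sandwich a b w p : trivial_mod S w p ->
  trivial_mod S (a * w * b)%M (sandwich a b p).
Proof.
apply: (spanned_sandwich (Q := fun v => (v < w)%O)
  (Q' := fun v => (v < a * w * b)%M%O)) => v; exact: deglex_lt_mul.
Qed.

Lemma trivial_mod_below w p : trivial_mod S w p -> below w p.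
Proof.
apply: (spanned_ind (Q := fun v => (v < w)%O) (F := below w)).
    exact: below0.
  exact: belowD.
by move=> c a b s Ss lw; apply: belowZ => v /lead_max vl; apply: le_lt_trans lw.
Qed.

(** Finitely many summands have a largest leading word. This supplies the word on which the diamond
    lemma inducts and, for the predicate [v < w], the passage to a smaller one. *)
Lemma spanned_max Q p : spanned Q p ->
  p = 0 \/ exists2 w, Q w & spanned (fun v => v <= w)%O p.
Proof.
move: p; apply: spanned_ind; first by left.
  move=> p q [->|[w Qw sp]]; first by rewrite add0r.
  case=> [->|[w' Qw' sq]]; first by rewrite addr0; right; exists w.
  right; case: (leP w w') => ww'; [exists w'|exists w] => //.
    by apply: spannedD => //; apply: spannedW sp => v /le_trans; apply.
  apply: spannedD => //; apply: spannedW sq => v /le_trans; apply; exact: ltW.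
move=> c a b s Ss Qs; right; exists (lead (sandwich a b s)) => //.
by apply: spannedZ; apply: spanned_sandwich_gen.
Qed.

End Span.

Section CompositionDiamond.
Variables (k : fieldType) (d : Order.disp_t) (Y : orderType d).
Variable (S : set (freenu k Y)).
Hypothesis S_GS : GS_basis S.
Local Notation P := {malg k[{fmonom Y}]}.
Implicit Types (p q : P) (s : freenu k Y) (a b u v w : {fmonom Y}).

Let S_monic s : S s -> is_monic s. Proof. exact: S_GS.1. Qed.

(** The occurrences of the two leading words are disjoint, nested or overlapping. Disjoint ones need
    only [overlap_identity]; otherwise the difference is a multiple of a composition. *)
Lemma trivial_mod_overlap_aux s1 s2 c b1 b2 : S s1 -> S s2 ->
  (lead s1 * b1)%M = (c * (lead s2 * b2))%M ->
  trivial_mod S (lead s1 * b1)%M (sandwich 1%M b1 s1 - sandwich c b2 s2).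
Proof.
move=> S1 S2 e; case: (leqP (size (lead s1)) (size c)) => [le|lt].
  have [x [cE b1E]] := fmonom_catI e le.
  have -> : sandwich 1%M b1 s1 - sandwich c b2 s2 =
     (s1 : P) * sandwich x b2 (<< lead s2 >> - s2) +
     sandwich 1%M x ((s1 : P) - << lead s1 >>) * s2 * << b2 >>.
    rewrite !sandwichr b1E cE !sandwichM; move: (lead s1) (lead s2) => u1 u2.
    rewrite -(malgUM k x (u2 * b2)) -(malgUM k u2 b2) -(malgUM k u1 x).
    exact: overlap_identity.
  rewrite trivial_modE; apply: spannedD.
    apply: spanned_mulr => // _ /msupp_sandwich[v vs ->]; rewrite b1E.
    move: vs; rewrite -opprB msuppN => /(lead_below (S_monic S2)) vs.
    by rewrite !mulmA; apply: deglex_lt_mul.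
  apply: spanned_mull => // _ /msupp_sandwich[v vs ->]; rewrite b1E.
  have := deglex_lt_mul 1%M (x * (lead s2 * b2))%M (lead_below (S_monic S1) vs).
  by rewrite !mul1m !mulmA.
have [x [s1E]] := fmonom_catI (esym e) (ltnW lt) => {}e.
case: (leqP (size (lead s2)) (size x)) => [le|lt'].
  have [y [xE b2E]] := fmonom_catI e le.
  have -> : sandwich 1%M b1 s1 - sandwich c b2 s2 =
      sandwich 1%M b1 ((s1 : P) - << c >> * s2 * << y >>).
    by rewrite linearB /= -sandwichM sandwich_comp mul1m b2E.
  rewrite -[(lead s1 * b1)%M]mul1m mulmA; apply: trivial_mod_sandwich => //.
  apply: S_GS.2 S1 S2 _; apply: Inclusion => //.
  by rewrite s1E xE mulmA.
(* Here [c] may be empty: a leading word that is a proper prefix of the other one is treated as an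
   intersection with empty left factor. *)
have [y [s2E b1E]] := fmonom_catI (esym e) (ltnW lt').
have -> : sandwich 1%M b1 s1 - sandwich c b2 s2 =
    sandwich 1%M b2 (sandwich 1%M y s1 - sandwich c 1%M s2).
  by rewrite linearB /= !sandwich_comp !mul1m b1E.
have -> : (lead s1 * b1 = 1 * (lead s1 * y) * b2)%M by rewrite mul1m b1E mulmA.
apply: trivial_mod_sandwich => //; rewrite sandwichr sandwichl.
apply: S_GS.2 S1 S2 _; apply: Intersection => //.
  by rewrite s1E s2E mulmA.
rewrite fmM size_cat ltn_add2l s2E fmM size_cat -[X in (X < _)%N]add0n ltn_add2r.
by move: lt; rewrite s1E fmM size_cat -[X in (X < _)%N]addn0 ltn_add2l.
Qed.

(** Reduces arbitrary positions to the previous case: the sign exchanges the two relations, and the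
    common left factor is stripped. *)
Lemma trivial_mod_overlap s1 s2 a1 b1 a2 b2 : S s1 -> S s2 ->
  (a1 * lead s1 * b1)%M = (a2 * lead s2 * b2)%M ->
  trivial_mod S (a1 * lead s1 * b1)%M (sandwich a1 b1 s1 - sandwich a2 b2 s2).
Proof.
wlog le : s1 s2 a1 b1 a2 b2 / (size a1 <= size a2)%N => [IH|] S1 S2 e.
  case: (leqP (size a1) (size a2)) => [le|/ltnW le]; first exact: IH.
  rewrite -opprB e trivial_modE; apply: spannedN; rewrite -trivial_modE.
  exact: IH.
have [c [a2E e']] : exists c, a2 = (a1 * c)%M /\
    (lead s1 * b1)%M = (c * (lead s2 * b2))%M.
  by apply: fmonom_catI => //; rewrite !mulmA.
have -> : sandwich a1 b1 s1 - sandwich a2 b2 s2 =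
    sandwich a1 1%M (sandwich 1%M b1 s1 - sandwich c b2 s2).
  by rewrite linearB /= !sandwich_comp !mulm1 a2E.
rewrite -mulmA -[X in trivial_mod _ X]mulm1.
by apply: trivial_mod_sandwich => //; apply: trivial_mod_overlap_aux.
Qed.

Hypothesis Y_wo : well_order (<=%O : rel Y).

(* Collecting the summands with maximal leading word [w] leaves a multiple of a
   single one of them and a remainder that is trivial modulo [S] and [w]. *)
Lemma composition_diamond p : spanned S (fun _ => True) p -> p != 0 ->
  exists s a b, S s /\ lead p = (a * lead s * b)%M.
Proof.
move=> /spanned_max[->|[w _]]; first by rewrite eqxx.
move: w p; apply: (deglex_ind Y_wo) => w IH p sp nz.
pose T := spanned S (fun v => (v < w)%O).
pose F p' := exists2 q, T q & p' = q \/ exists c s a b,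
    [/\ S s, (a * lead s * b)%M = w & p' = c *: sandwich a b s + q].
have [q qw pE] : F p.
  move: p sp {nz}; apply: (spanned_ind (F := F)).
  - by exists 0; [exact: spanned0|left].
  - move=> p1 p2 [q1 q1w E1] [q2 q2w E2].
    case: E1 => [->|[c1 [s1 [a1 [b1 [S1 e1 ->]]]]]].
      exists (q1 + q2); first exact: spannedD.
      case: E2 => [->|[c2 [s2 [a2 [b2 [S2 e2 ->]]]]]]; [by left|right].
      by exists c2, s2, a2, b2; split=> //; rewrite addrCA.
    case: E2 => [->|[c2 [s2 [a2 [b2 [S2 e2 ->]]]]]].
      exists (q1 + q2); first exact: spannedD.
      by right; exists c1, s1, a1, b1; split=> //; rewrite addrA.
    exists (q1 + q2 - c2 *: (sandwich a1 b1 s1 - sandwich a2 b2 s2)).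
      apply: spannedB; first exact: spannedD.
      apply: spannedZ; rewrite -trivial_modE -e1; apply: trivial_mod_overlap => //.
      by rewrite e1 e2.
    right; exists (c1 + c2), s1, a1, b1; split=> //.
    exact: merge_identity.
  move=> c a b s Ss; rewrite lead_sandwich; last exact: S_monic.
  rewrite le_eqVlt => /orP[/eqP|] lw; last first.
    exists (c *: sandwich a b s); last by left.
    by apply/spannedZ/spanned_gen.
  exists 0; first exact: spanned0.
  by right; exists c, s, a, b; rewrite addr0.
(* Without a top summand all leading words are below [w], hence bounded by some [w' < w], and the
   induction hypothesis applies. *)
have qcase : p = q -> exists s a b, S s /\ lead p = (a * lead s * b)%M.
  move=> pq; rewrite pq in nz *.
  case: (spanned_max qw) => [q0|[w' w'w sq]]; first by rewrite q0 eqxx in nz.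
  exact: (IH w').
case: pE => // -[c [s [a [b [Ss wE pE]]]]].
have [c0|nc] := eqVneq c 0; first by apply: qcase; rewrite pE c0 scale0r add0r.
exists s, a, b; split=> //; rewrite wE.
(* Dividing by the nonzero coefficient keeps the support and makes the polynomial monic, as
   [below_lead] requires. *)
have -> : lead p = lead (c^-1 *: p).
  by rewrite /lead msuppZ invr_eq0 (negPf nc).
suff /below_lead[] : below w (c^-1 *: p - << w >>) by [].
rewrite pE scalerDr scalerA mulVf // scale1r addrAC; apply: belowD.
  rewrite -wE -sandwichU -linearB /=.
  exact: below_sandwich (lead_below (S_monic Ss)).
by apply: belowZ; apply: trivial_mod_below qw.
Qed.

End CompositionDiamond.

(** * Homomorphisms of algebras without identity *)

Section NuAlgebraFacts.
Variables (k : fieldType) (A : nuAlgType k).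
Implicit Types (x y z : A).

Lemma numul0l x : 0 ** x = 0.
Proof. by rewrite -(scale0r (0 : A)) numulZl !scale0r. Qed.

Lemma numul0r x : x ** 0 = 0.
Proof. by rewrite -(scale0r (0 : A)) numulZr !scale0r. Qed.

End NuAlgebraFacts.

(** The bimodule actions and the induced maps come with a mere proof of linearity; packaging them
    gives access to the theory of linear maps. *)
Lemma linear_existence (k : fieldType) (U V : lmodType k) (F : U -> V) :
  linear F -> exists G : {linear U -> V}, G =1 F.
Proof.
move=> linF; pose linM := GRing.isLinear.Build k U V *:%R F linF.
by exists (HB.pack F linM : {linear U -> V}).
Qed.

Section NuQuotientFacts.
Variables (k : fieldType) (A : nuAlgType k) (S : set A).
Implicit Types (x y z : A).

Fact nuclass_linear : linear (nuclass S).
Proof. by move=> a x y; rewrite nuclassD nuclassZE. Qed.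

HB.instance Definition _ :=
  GRing.isLinear.Build k A (nuquot S) *:%R (nuclass S) nuclass_linear.

Lemma nuclassME x y : nuclass S (x ** y) = nuclass S x ** nuclass S y.
Proof. by rewrite -nuclassM. Qed.

Lemma nuclass_eq0 x : nuclass S x = 0 <-> ideal_gen S x.
Proof. by rewrite -(linear0 (nuclass S)) nuclass_eq subr0. Qed.

Lemma nuclass_rel x : S x -> nuclass S x = 0.
Proof. by move=> Sx; apply/nuclass_eq0 => I _ SI; apply: SI. Qed.

Section Lift.
Variables (C : nuAlgType k) (F : {linear A -> C}).
Hypothesis FM : forall x y, F (x ** y) = F x ** F y.
Hypothesis FS : forall x, S x -> F x = 0.

Lemma linear_hom_ker x : ideal_gen S x -> F x = 0.
Proof.
move=> /(_ [set z | F z = 0]); apply => //; split=> /=.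
- exact: linear0.
- by move=> y z Fy Fz; rewrite linearD /= Fy Fz addr0.
- by move=> a y Fy; rewrite linearZ /= Fy scaler0.
- by move=> y z Fz; rewrite FM Fz numul0r.
- by move=> y z Fy; rewrite FM Fy numul0l.
Qed.

(** Universal property of the quotient, evaluated on chosen representatives; [linear_hom_ker] makes
    the choice irrelevant. *)
Lemma nuquot_lift : exists phi : {linear nuquot S -> C},
  (forall p q, phi (p ** q) = phi p ** phi q) /\
  (forall x, phi (nuclass S x) = F x).
Proof.
pose phi (q : nuquot S) := F (nurepr q).
have phiE x : phi (nuclass S x) = F x.
  apply: subr0_eq; rewrite /phi -linearB.
  by apply: linear_hom_ker; apply: nureprP.
have phil : linear phi.
  move=> a p q; rewrite -(nureprK p) -(nureprK q) !phiE.
  by rewrite -nuclassZE -nuclassD phiE linearP.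
have [G GE] := linear_existence phil; exists G; split=> [p q|x]; rewrite !GE //.
by rewrite -(nureprK p) -(nureprK q) -nuclassME !phiE FM.
Qed.

End Lift.
End NuQuotientFacts.

(** * The free algebra without identity and its universal property *)

Section FreeFacts.
Variables (k : fieldType) (Y : choiceType).
Local Notation FY := (freenu k Y).
Implicit Types (p q : FY) (u v w : {fmonom Y}).

Lemma freenuD p q : (p + q : FY) = (p : {malg k[{fmonom Y}]}) + q :> {malg _[_]}.
Proof. by []. Qed.

Lemma freenuZ (a : k) p :
  (a *: p : FY) = a *: (p : {malg k[{fmonom Y}]}) :> {malg _[_]}.
Proof. by []. Qed.

Fact freenu_val_linear : linear (@freenu_val k Y).
Proof. by []. Qed.

HB.instance Definition _ :=
  GRing.isLinear.Build k FY {malg k[{fmonom Y}]} *:%R (@freenu_val k Y)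
    freenu_val_linear.

Lemma freenuM p q : (p ** q : FY) = (p : {malg k[{fmonom Y}]}) * q :> {malg _[_]}.
Proof. by []. Qed.

Lemma freenu_msupp1 p : 1%M \notin msupp (p : {malg k[{fmonom Y}]}).
Proof. by rewrite -mcoeff_eq0; case: p. Qed.

Lemma word_val w : w != 1%M -> word k w = << w >> :> {malg k[{fmonom Y}]}.
Proof.
move=> w1; rewrite /word -[freenu_val _]/(val _) val_insubd unfold_in.
by rewrite mcoeffU (negPf w1) eqxx.
Qed.

Lemma fmu_neq1 (y : Y) : fmu y != 1%M.
Proof. by rewrite fm1_eq1. Qed.

Lemma letter_val (y : Y) : letter k y = << fmu y >> :> {malg k[{fmonom Y}]}.
Proof. by rewrite /letter word_val // fmu_neq1. Qed.

Lemma freenu_lext p : p = lext (@word k Y) p.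
Proof.
apply: val_inj => /=; rewrite (linear_lext (@freenu_val k Y)) -[LHS]lext_id.
apply: lext_eq => w wp; rewrite /= word_val //.
by apply: contraNneq (freenu_msupp1 p) => <-.
Qed.

Lemma freenu_ind (F : FY -> Prop) : F 0 ->
  (forall p q, F p -> F q -> F (p + q)) -> (forall a p, F p -> F (a *: p)) ->
  (forall w, w != 1%M -> F (word k w)) -> forall p, F p.
Proof.
move=> F0 FD FZ Fw p; rewrite (freenu_lext p) /lext big_seq.
apply: (big_ind F) => // w wp; apply/FZ/Fw.
by apply: contraNneq (freenu_msupp1 p) => <-.
Qed.

Lemma wordM u v : u != 1%M -> v != 1%M ->
  word k (u * v)%M = word k u ** word k v.
Proof.
move=> u1 v1; have uv1 : (u * v)%M != 1%M by rewrite fmM_eq1 negb_and u1.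
apply: val_inj; rewrite -[LHS]/(freenu_val _) -[RHS]/(freenu_val _).
by rewrite (word_val uv1) -malgUM -(word_val u1) -(word_val v1).
Qed.

Lemma fmonom_consE y (s : seq Y) : FMonom (y :: s) = (fmu y * FMonom s)%M.
Proof. by apply: fmonom_inj; rewrite fmM fmU. Qed.

Lemma FMonom_eq1 (s : seq Y) : (FMonom s == 1%M) = (s == [::]).
Proof. by rewrite fmP fm1. Qed.

Lemma freenu_letter_ind (F : FY -> Prop) : F 0 ->
  (forall p q, F p -> F q -> F (p + q)) -> (forall a p, F p -> F (a *: p)) ->
  (forall y, F (letter k y)) -> (forall p q, F p -> F q -> F (p ** q)) ->
  forall p, F p.
Proof.
move=> F0 FD FZ Fl FM; apply: freenu_ind => // -[s].
rewrite FMonom_eq1; elim: s => // y [_ _|z s IH _].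
  suff -> : FMonom [:: y] = fmu y by apply: Fl.
  by apply: fmonom_inj; rewrite fmU.
rewrite fmonom_consE wordM ?fmu_neq1 ?FMonom_eq1 //.
by apply: FM; [apply: Fl|apply: IH].
Qed.

Lemma freenu_hom_eq (A : nuAlgType k) (F G : {linear FY -> A}) :
  (forall p q, F (p ** q) = F p ** F q) ->
  (forall p q, G (p ** q) = G p ** G q) ->
  (forall y, F (letter k y) = G (letter k y)) -> F =1 G.
Proof.
move=> FM GM FG; apply: freenu_letter_ind => // [|p q Hp Hq|a p Hp|p q Hp Hq].
- by rewrite !linear0.
- by rewrite !linearD Hp Hq.
- by rewrite !linearZ Hp.
by rewrite FM GM Hp Hq.
Qed.

Variables (A : nuAlgType k) (h : Y -> A).

(** Without an identity in [A] the product has to start from the first letter. The default 0 agrees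
    with [word k 1%M = 0], so [free_hom_word] holds for all words. *)
Definition word_eval (s : seq Y) : A :=
  if s is y :: t then foldl (fun a z => a ** h z) (h y) t else 0.

Lemma word_eval_cat s t : s != [::] -> t != [::] ->
  word_eval (s ++ t) = word_eval s ** word_eval t.
Proof.
case: s t => // y s [//|z t] _ _ /=; rewrite foldl_cat /=.
by elim/last_ind: t => //= t x IH; rewrite !foldl_rcons IH numulA.
Qed.

Definition free_hom (p : FY) : A :=
  lext (fun w : {fmonom Y} => word_eval w) p.

Fact free_hom_linear : linear free_hom.
Proof. by move=> a p q; rewrite /free_hom freenuD freenuZ linearP. Qed.

HB.instance Definition _ :=
  GRing.isLinear.Build k FY A *:%R free_hom free_hom_linear.

Lemma free_hom_word w : free_hom (word k w) = word_eval w.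
Proof.
have [->|w1] := eqVneq w 1%M; last by rewrite /free_hom word_val // lextU.
rewrite fm1 /= /free_hom /word -[freenu_val _]/(val _) val_insubd unfold_in.
by rewrite mcoeffUU oner_eq0 linear0.
Qed.

Lemma free_hom_letter y : free_hom (letter k y) = h y.
Proof. by rewrite free_hom_word fmU. Qed.

Lemma free_homM p q : free_hom (p ** q) = free_hom p ** free_hom q.
Proof.
move: p; apply: freenu_ind => [|p p' Hp Hp'|a p Hp|u u1].
- by rewrite numul0l linear0 numul0l.
- by rewrite numulDl !linearD /= Hp Hp' numulDl.
- by rewrite numulZl !linearZ /= Hp numulZl.
move: q; apply: freenu_ind => [|q q' Hq Hq'|a q Hq|v v1].
- by rewrite numul0r linear0 numul0r.
- by rewrite numulDr !linearD /= Hq Hq' numulDr.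
- by rewrite numulZr !linearZ /= Hq numulZr.
have -> : word k u ** word k v = word k (u * v)%M by rewrite wordM.
apply: etrans (free_hom_word _) _; rewrite fmM word_eval_cat -?fm1 -?fmP //.
by rewrite -(free_hom_word u) -(free_hom_word v).
Qed.

End FreeFacts.

(** * Bimodules and the relations [S_1] *)

(* Unification must not compare distinct words by unfolding. *)
#[local] Opaque lead word nuclass.

Lemma sum_well_order (d1 d2 : Order.disp_t) (T1 : orderType d1)
    (T2 : orderType d2) :
  well_order (<=%O : rel T1) -> well_order (<=%O : rel T2) ->
  well_order (<=%O : rel (T1 + T2)%type).
Proof.
move=> wo1 wo2; apply: antisymmetric_well_order; first exact: le_anti.
move=> A [z0 Az0].
case: (pselect (exists x, inl x \in A)) => [[x Ax]|no].
  have [|x0 [[Ax0 x0min] _]] := wo1 [pred x | inl x \in A]; first by exists x.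
  by exists (inl x0); split=> // -[y Ay|//]; apply: x0min.
case: z0 Az0 => [x Ax|y Ay]; first by case: no; exists x.
have [|y0 [[Ay0 y0min] _]] := wo2 [pred y | inr y \in A]; first by exists y.
exists (inr y0); split=> // -[x Ax|z Az]; first by case: no; exists x.
exact: y0min.
Qed.

Section Basis.
Variables (k : fieldType) (M : lmodType k) (J : choiceType) (m : J -> M).
Hypothesis m_basis : is_basis m.

Lemma basis_coordK v : lext m (basis_coord m v) = v.
Proof.
have [c [cv _]] := m_basis v.
exact: (@xgetPex _ 0 [set c | lincomb m c = v] (ex_intro _ c cv)).
Qed.

Lemma basis_coord_unique c : basis_coord m (lext m c) = c.
Proof.
have [c' [_ c'u]] := m_basis (lext m c).
by rewrite -(c'u _ (basis_coordK _)); apply: c'u.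
Qed.

Lemma basis_coord_linear : linear (basis_coord m).
Proof.
move=> a u v; rewrite -{1}(basis_coordK u) -{1}(basis_coordK v) -linearP.
exact: basis_coord_unique.
Qed.

Lemma basis_coord_gen j : basis_coord m (m j) = << j >>.
Proof. by rewrite -[RHS]basis_coord_unique lextU. Qed.

End Basis.

Section ExtensionTheory.
Variables (k : fieldType) (dX dJ : Order.disp_t).
Variables (X : orderType dX) (J : orderType dJ).
Variables (Lambda : set {fmonom X}) (f : {fmonom X} -> freenu k X).
Variables (M : lmodType k).
Variables (lact : algB Lambda f -> M -> M) (ract : M -> algB Lambda f -> M).
Hypothesis M_bimodule : is_bimodule lact ract.
Variables (m : J -> M).

Local Notation cl := (nuclass (R_rel Lambda f)).
Local Notation Y := (J + X)%type.
Implicit Types (s t a b : seq Y) (v : M) (y : Y).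

(** * Actions of words on M and values of words *)

Definition is_m y := if y is inl _ then true else false.

(** The action of the free algebra on all generators, with the [m_j] acting as zero since [M^2 = 0].
    Defined letter by letter, it is compatible with concatenation by construction; [lact_word_inr]
    compares it with the action through classes in [B]. *)
Definition lact_word s v :=
  foldr (fun y v => if y is inr x then lact (cl (letter k x)) v else 0) v s.

Definition ract_word s v :=
  foldl (fun v y => if y is inr x then ract v (cl (letter k x)) else 0) v s.

(** Words over [X] end in the default 0; a second letter [m_l] kills the value through
    [ract_word]. *)
Fixpoint mval s : M :=
  match s with
  | [::] => 0
  | inl j :: t => ract_word t (m j)
  | inr x :: t => lact (cl (letter k x)) (mval t)
  end.

Fact lact_word_linear s : linear (lact_word s).
Proof.
elim: s => [|[j|x] s IH] c u v //=; first by rewrite scaler0 addr0.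
by rewrite IH (lact_linearr M_bimodule).
Qed.

HB.instance Definition _ s :=
  GRing.isLinear.Build k M M *:%R (lact_word s) (lact_word_linear s).

Fact ract_word_linear s : linear (ract_word s).
Proof.
rewrite /ract_word => c u v; elim: s u v => [|[j|x] s IH] u v //=.
  by rewrite -IH scaler0 addr0.
by rewrite (ract_linearl M_bimodule) IH.
Qed.

HB.instance Definition _ s :=
  GRing.isLinear.Build k M M *:%R (ract_word s) (ract_word_linear s).

Lemma ract_word_cons y s v : ract_word (y :: s) v =
  ract_word s (if y is inr x then ract v (cl (letter k x)) else 0).
Proof. by []. Qed.

Lemma lact_word_cat s t v : lact_word (s ++ t) v = lact_word s (lact_word t v).
Proof. exact: foldr_cat. Qed.

Lemma ract_word_cat s t v : ract_word (s ++ t) v = ract_word t (ract_word s v).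
Proof. exact: foldl_cat. Qed.

Lemma lact_word_has_m s v : has is_m s -> lact_word s v = 0.
Proof.
elim: s => [|[j|x] s IH] //= /IH ->.
have [g gE] := linear_existence (lact_linearr M_bimodule (cl (letter k x))).
by rewrite -gE linear0.
Qed.

Lemma ract_word_has_m s v : has is_m s -> ract_word s v = 0.
Proof.
elim: s v => [|[j|x] s IH] v //=; last exact: IH.
by move=> _; apply: (linear0 (ract_word s)).
Qed.

Lemma lract_word s t v : ract_word t (lact_word s v) = lact_word s (ract_word t v).
Proof.
elim: s => [|[j|x] s IH] //=; first by rewrite linear0.
rewrite -IH {IH}; move: (lact_word s v) => {}v.
elim: t v => [//|[j|x'] t IHt] v; rewrite !ract_word_cons.
  (* [lact_word [:: inr x; inl j] v] unfolds to the action of [x] on 0, which is what remains. *)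
  by rewrite linear0; apply/esym/(lact_word_has_m (s := [:: inr x; inl j]) v).
by rewrite (lract M_bimodule) IHt.
Qed.

Lemma mval_catr s t : has is_m s -> mval (s ++ t) = ract_word t (mval s).
Proof.
elim: s => [|[j|x] s IH] //= => [_|/IH ->]; first exact: ract_word_cat.
exact/esym/(lract_word [:: inr x]).
Qed.

Lemma mval_catl s t : has is_m t -> mval (s ++ t) = lact_word s (mval t).
Proof.
move=> mt; elim: s => [|[j|x] s IH] //=; last by rewrite IH.
by rewrite ract_word_has_m // has_cat mt orbT.
Qed.

Lemma mval_cat a s b : has is_m s ->
  mval (a ++ s ++ b) = lact_word a (ract_word b (mval s)).
Proof. by move=> ms; rewrite mval_catl ?mval_catr // has_cat ms. Qed.

Lemma class_word_cons x (s : seq X) : s != [::] ->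
  cl (word k (FMonom (x :: s))) = cl (letter k x) ** cl (word k (FMonom s)).
Proof.
by move=> s0; rewrite fmonom_consE wordM ?nuclassME ?fmu_neq1 ?FMonom_eq1.
Qed.

Lemma wlact_nil v : wlact lact (FMonom [::]) v = v.
Proof. by rewrite /wlact ifT // FMonom_eq1. Qed.

Lemma wract_nil v : wract ract v (FMonom [::]) = v.
Proof. by rewrite /wract ifT // FMonom_eq1. Qed.

Lemma wlactE (s : seq X) v : s != [::] ->
  wlact lact (FMonom s) v = lact (cl (word k (FMonom s))) v.
Proof. by move=> s0; rewrite /wlact ifN // FMonom_eq1. Qed.

Lemma wractE (s : seq X) v : s != [::] ->
  wract ract v (FMonom s) = ract v (cl (word k (FMonom s))).
Proof. by move=> s0; rewrite /wract ifN // FMonom_eq1. Qed.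

Lemma class_letter x : cl (word k (FMonom [:: x])) = cl (letter k x).
Proof. by rewrite /letter fmuE. Qed.

Lemma wlact_cons x (s : seq X) v : wlact lact (FMonom (x :: s)) v =
  lact (cl (letter k x)) (wlact lact (FMonom s) v).
Proof.
rewrite wlactE //; case: s => [|z s].
  by rewrite wlact_nil; apply: (congr1 (lact^~ v) (class_letter x)).
rewrite (wlactE (s := z :: s) _ isT); have E := class_word_cons x (s := z :: s) isT.
exact: etrans (congr1 (lact^~ v) E) (lactA M_bimodule _ _ _).
Qed.

Lemma wract_cons x (s : seq X) v : wract ract v (FMonom (x :: s)) =
  wract ract (ract v (cl (letter k x))) (FMonom s).
Proof.
rewrite wractE //; case: s => [|z s].
  by rewrite wract_nil; apply: (congr1 (ract v) (class_letter x)).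
rewrite (wractE (s := z :: s) _ isT); have E := class_word_cons x (s := z :: s) isT.
exact: etrans (congr1 (ract v) E) (ractA M_bimodule _ _ _).
Qed.

Lemma lact_word_inr (s : seq X) v :
  lact_word (map inr s) v = wlact lact (FMonom s) v.
Proof.
elim: s => [|x s IH]; first by rewrite wlact_nil.
by rewrite wlact_cons -IH.
Qed.

Lemma ract_word_inr (s : seq X) v :
  ract_word (map inr s) v = wract ract v (FMonom s).
Proof.
elim: s v => [|x s IH] v; first by rewrite wract_nil.
by rewrite wract_cons -IH.
Qed.

(** The class of [p] in [B] is the combination of the classes of its words, all nonempty because [p]
    has no constant term. Consequently each [h_u] acts as zero letter by letter. *)
Lemma lact_word_poly (p : freenu k X) v :
  lext (fun w : {fmonom X} => lact_word (map inr w) v) p = lact (cl p) v.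
Proof.
have [g gE] := linear_existence (lact_linearl M_bimodule v).
have clE : cl p = lext (fun w : {fmonom X} => cl (word k w)) p.
  by rewrite [in LHS](freenu_lext p) (linear_lext (nuclass _)).
rewrite -gE clE (linear_lext g); apply: lext_eq => w wp.
rewrite lact_word_inr wlactE; first by rewrite fmK -gE.
by rewrite -fm1 -fmP; apply: contraNneq (freenu_msupp1 p) => <-.
Qed.

Lemma ract_word_poly (p : freenu k X) v :
  lext (fun w : {fmonom X} => ract_word (map inr w) v) p = ract v (cl p).
Proof.
have [g gE] := linear_existence (ract_linearr M_bimodule v).
have clE : cl p = lext (fun w : {fmonom X} => cl (word k w)) p.
  by rewrite [in LHS](freenu_lext p) (linear_lext (nuclass _)).
rewrite -gE clE (linear_lext g); apply: lext_eq => w wp.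
rewrite ract_word_inr wractE; first by rewrite fmK -gE.
by rewrite -fm1 -fmP; apply: contraNneq (freenu_msupp1 p) => <-.
Qed.

(** * The relations S_1 and their leading words *)

Hypothesis Lambda_nonempty : forall u, Lambda u -> u != 1%M.
Hypothesis Lambda_lead : forall u, Lambda u -> lead (hrel f u) = u.
Hypothesis R_GS : GS_basis (R_rel Lambda f).
Hypothesis m_basis : is_basis m.
Variable mu : {fmonom X} -> M.

Local Notation P := {malg k[{fmonom Y}]}.
Local Notation FA := (freenu k Y).
Local Notation S1 := (S1_rel lact ract m mu).

Definition xword (w : {fmonom X}) : {fmonom Y} := FMonom (map inr w).
Definition mword (j : J) : {fmonom Y} := FMonom [:: inl j].
Definition word2 (y z : Y) : {fmonom Y} := FMonom [:: y; z].

Local Notation xpoly := (lext (fun w => << xword w >> : P)).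

Definition mpoly v : P := lext (fun j => << mword j >>) (basis_coord m v).

Fact mpoly_linear : linear mpoly.
Proof. by move=> c u v; rewrite /mpoly (basis_coord_linear m_basis) linearP. Qed.

HB.instance Definition _ := GRing.isLinear.Build k M P *:%R mpoly mpoly_linear.

Definition mvalp (p : P) : M := lext (fun w : {fmonom Y} => mval w) p.

Fact mvalp_linear : linear mvalp. Proof. exact: linearP. Qed.

HB.instance Definition _ := GRing.isLinear.Build k P M *:%R mvalp mvalp_linear.

Lemma mvalp_mpoly v : mvalp (mpoly v) = v.
Proof.
rewrite /mvalp /mpoly linear_lext -[RHS](basis_coordK m_basis).
by apply: lext_eq => j _ /=; rewrite lextU.
Qed.

Lemma mpoly_gen j : mpoly (m j) = << mword j >>.
Proof. by rewrite /mpoly basis_coord_gen // lextU. Qed.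

Lemma xwordM u w : xword (u * w)%M = (xword u * xword w)%M.
Proof. by apply: fmonom_inj; rewrite fmM /= fmM map_cat. Qed.

Lemma xword_has_m w : has is_m (xword w) = false.
Proof. by apply/negbTE/hasPn => _ /mapP[x _ ->]. Qed.

Lemma xword_inj : injective xword.
Proof.
move=> u w /(congr1 (@fmonom_val _)) /= /inj_map uw; apply: fmonom_inj.
by apply: uw => x y [].
Qed.

Lemma no_m_xword (w : {fmonom Y}) : ~~ has is_m w -> exists w', w = xword w'.
Proof.
move=> nw; suff [s ws] : exists s : seq X, (w : seq Y) = map inr s.
  by exists (FMonom s); apply: fmonom_inj.
elim: (w : seq Y) nw => [|[j|x] s IH] //=; first by exists [::].
by move=> /IH [t ->]; exists (x :: t).
Qed.

Lemma xword_lt u w : (u < w)%O -> (xword u < xword w)%O.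
Proof.
rewrite !deglex_ltE /= !size_map => /orP[->//|/andP[/eqP uw lt]].
rewrite uw eqxx /=; apply/orP; right; move: uw lt.
elim: (u : seq X) (w : seq X) => [|x s IH] [|y t] //= [st].
rewrite !ltxi_cons; have -> : (inr x <= inr y :> Y)%O = (x <= y)%O by [].
have -> : (inr y <= inr x :> Y)%O = (y <= x)%O by [].
by case: (ltgtP x y) => //= _; apply: IH.
Qed.

(** For words of length one this is the convention [x > m_j]. It keeps [u] the leading word of
    [u - f_u - (u)] even when [u] is a single letter. *)
Lemma mword_xword j w : w != 1%M -> (mword j < xword w)%O.
Proof.
rewrite fmP fm1 deglex_ltE /= size_map; case: (w : seq X) => // x [|//] _ /=.
by rewrite ltxi_cons.
Qed.

Lemma mpoly_below w v : (forall j, (mword j < w)%O) -> below w (mpoly v).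
Proof. by move=> H; apply: below_lext => j _; apply: belowU. Qed.

Lemma mpoly_has_m v w : w \in msupp (mpoly v) -> exists j, w = mword j.
Proof.
move=> /msupp_lext[j _]; rewrite msuppU oner_eq0 inE => /eqP ->.
by exists j.
Qed.

Lemma xpoly_sandwich (a b : {fmonom X}) (p : {malg k[{fmonom X}]}) :
  xpoly (sandwich a b p) = sandwich (xword a) (xword b) (xpoly p).
Proof.
rewrite lext_sandwich linear_lext; apply: lext_eq => w _ /=.
by rewrite sandwichU !xwordM.
Qed.

Lemma word2M y z : word2 y z = (fmu y * fmu z)%M.
Proof. by apply: fmonom_inj; rewrite fmM !fmU. Qed.

Lemma m_poly_val v : m_poly X m v = mpoly v :> P.
Proof.
rewrite /m_poly -/(lext _ _) (linear_lext (@freenu_val k _)).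
by apply: lext_eq => j _ /=; rewrite /m_letter letter_val fmuE.
Qed.

Lemma S1_u_val u : Lambda u ->
  word k (FMonom (map inr u)) - (freenu_map inr (f u) + m_poly X m (mu u)) =
  xpoly (hrel f u) - mpoly (mu u) :> P.
Proof.
move=> Lu; have u1 := Lambda_nonempty Lu.
have xu1 : FMonom (map (@inr J X) u) != 1%M.
  by move: u1; rewrite !fmP !fm1 /=; case: (u : seq X).
rewrite !linearB !linearD /= (word_val k xu1) (word_val k u1) lextU m_poly_val.
rewrite addrA; congr (_ - _ - _).
rewrite /freenu_map -/(lext _ _) (linear_lext (@freenu_val k _)).
apply: lext_eq => w wf /=; rewrite word_val // FMonom_eq1.
have : w != 1%M by apply: contraNneq (freenu_msupp1 (f u)) => <-.
by rewrite fmP fm1; case: (w : seq X).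
Qed.

Lemma letters_val y z :
  letter k y ** letter k z = << word2 y z >> :> P.
Proof. by rewrite word2M -malgUM -(letter_val k y) -(letter_val k z). Qed.

Lemma letters_sub_val y z (v : M) :
  letter k y ** letter k z - m_poly X m v = << word2 y z >> - mpoly v :> P.
Proof. by rewrite -letters_val -(m_poly_val v). Qed.

(** The three families of relations with a letter [m_j] take one shape, a two-letter word minus its
    value; [m_j m_l] fits in because its value is 0. *)
Lemma S1P (s : FA) : S1 s <->
  (exists2 u, Lambda u & (s : P) = xpoly (hrel f u) - mpoly (mu u)) \/
  (exists y z, is_m y || is_m z /\
     (s : P) = << word2 y z >> - mpoly (mval [:: y; z])).
Proof.
have mm0 j l : mval [:: inl j; inl l] = 0 by [].
split=> [[[u Lu ->]|[x [j ->]]|[j [x ->]]|[j [l ->]]]|].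
- by left; exists u => //; apply: S1_u_val.
- by right; exists (inr x), (inl j); split=> //; apply: letters_sub_val.
- by right; exists (inl j), (inr x); split=> //; apply: letters_sub_val.
- right; exists (inl j), (inl l); split=> //.
  by rewrite mm0 linear0 subr0; apply: letters_val.
case=> [[u Lu sE]|[y [z [myz sE]]]].
  constructor 1; exists u => //; apply: val_inj.
  by apply: etrans sE _; rewrite -S1_u_val.
case: y z myz sE => [j|x] [l|x'] // _.
- rewrite mm0 linear0 subr0 -letters_val => sE.
  by constructor 4; exists j, l; apply: val_inj.
- rewrite -letters_sub_val => sE.
  by constructor 3; exists j, x'; apply: val_inj.
rewrite -letters_sub_val => sE.
by constructor 2; exists x, l; apply: val_inj.
Qed.

Lemma hrel_monic u : Lambda u -> is_monic (hrel f u).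
Proof. by move=> Lu; apply: R_GS.1; exists u. Qed.

Lemma S1_u_lead (s : FA) u : Lambda u ->
  (s : P) = xpoly (hrel f u) - mpoly (mu u) -> lead s = xword u /\ is_monic s.
Proof.
move=> Lu ->; apply: below_lead; rewrite addrAC; apply: belowB; last first.
  by apply: mpoly_below => j; apply/mword_xword/Lambda_nonempty.
have := lead_below (hrel_monic Lu); rewrite (Lambda_lead Lu) => hu.
rewrite -(lextU (fun w => << xword w >> : P) u) -linearB.
by apply: below_lext => w /hu /xword_lt; apply: belowU.
Qed.

Lemma mword_lt2 j y z : (mword j < word2 y z)%O.
Proof. exact: deglex_size_lt. Qed.

Lemma S1_2_lead (s : FA) y z v :
  (s : P) = << word2 y z >> - mpoly v -> lead s = word2 y z /\ is_monic s.
Proof.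
move=> ->; apply: below_lead; rewrite addrAC subrr add0r.
by apply/belowN/mpoly_below => j; apply: mword_lt2.
Qed.

Lemma S1_monic (s : FA) : S1 s -> is_monic s.
Proof.
case/S1P=> [[u Lu /(S1_u_lead Lu)[]//]|[y [z [_ /S1_2_lead[]//]]]].
Qed.

Lemma S1_u_ex u : Lambda u -> exists2 s : FA,
  S1 s & (s : P) = xpoly (hrel f u) - mpoly (mu u).
Proof.
move=> Lu; exists (word k (FMonom (map inr u)) -
  (freenu_map inr (f u) + m_poly X m (mu u))); last exact: S1_u_val.
by constructor 1; exists u.
Qed.

Lemma S1_2_ex y z : is_m y || is_m z -> exists2 s : FA,
  S1 s & (s : P) = << word2 y z >> - mpoly (mval [:: y; z]).
Proof.
move=> myz; exists (letter k y ** letter k z - m_poly X m (mval [:: y; z])).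
  by apply/S1P; right; exists y, z; split=> //; apply: letters_sub_val.
exact: letters_sub_val.
Qed.

(** * Vanishing values and reduction of words containing some m_j *)

Lemma S1_2_has_m (s : FA) y z v w : is_m y || is_m z ->
  (s : P) = << word2 y z >> - mpoly v -> w \in msupp (s : P) -> has is_m w.
Proof.
move=> myz -> /(fsubsetP (msuppB_le _ _)); rewrite in_fsetU => /orP[|].
  by rewrite msuppU oner_eq0 inE => /eqP ->; rewrite /= orbF.
by case/mpoly_has_m => j ->.
Qed.

(* A bimodule over [B] is annihilated by [S1] when the [m_j] act as zero. *)
Lemma S1_lact (s : FA) v : S1 s ->
  lext (fun w : {fmonom Y} => lact_word w v) s = 0.
Proof.
have mp0 v' : lext (fun w : {fmonom Y} => lact_word w v) (mpoly v') = 0.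
  rewrite /mpoly linear_lext /lext big1 // => j _ /=.
  by rewrite lextU /= scaler0.
case/S1P=> [[u Lu ->]|[y [z [myz ->]]]].
  rewrite linearB /= mp0 subr0 linear_lext.
  have -> : lext (lext (fun w : {fmonom Y} => lact_word w v) \o
                  (fun w => << xword w >> : P)) (hrel f u)
          = lext (fun w : {fmonom X} => lact_word (map inr w) v) (hrel f u).
    by apply: lext_eq => w _ /=; rewrite lextU.
  rewrite lact_word_poly nuclass_rel; last by exists u.
  have [g gE] := linear_existence (lact_linearl M_bimodule v).
  by rewrite -gE linear0.
by rewrite linearB /= mp0 subr0 lextU lact_word_has_m //= orbF.
Qed.

Lemma S1_ract (s : FA) v : S1 s ->
  lext (fun w : {fmonom Y} => ract_word w v) s = 0.
Proof.
have mp0 v' : lext (fun w : {fmonom Y} => ract_word w v) (mpoly v') = 0.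
  rewrite /mpoly linear_lext /lext big1 // => j _ /=.
  by rewrite lextU /= scaler0.
case/S1P=> [[u Lu ->]|[y [z [myz ->]]]].
  rewrite linearB /= mp0 subr0 linear_lext.
  have -> : lext (lext (fun w : {fmonom Y} => ract_word w v) \o
                  (fun w => << xword w >> : P)) (hrel f u)
          = lext (fun w : {fmonom X} => ract_word (map inr w) v) (hrel f u).
    by apply: lext_eq => w _ /=; rewrite lextU.
  rewrite ract_word_poly nuclass_rel; last by exists u.
  have [g gE] := linear_existence (ract_linearr M_bimodule v).
  by rewrite -gE linear0.
by rewrite linearB /= mp0 subr0 lextU ract_word_has_m //= orbF.
Qed.

(** If [a] or [b] contains some [m_j], then [s] acts on the value of that factor, and acts as zero.
    Otherwise the letter sits in the leading word of [s], which is then a two-letter relation and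
    has value 0 itself. *)
Lemma mvalp_sandwich_S1 (a b : {fmonom Y}) (s : FA) : S1 s ->
  has is_m (a * lead s * b)%M -> mvalp (sandwich a b s) = 0.
Proof.
move=> Ss; rewrite /mvalp lext_sandwich !fmM !has_cat => hm.
have [ma|na] := boolP (has is_m a).
  transitivity (ract_word b (lext (fun w : {fmonom Y} => ract_word w (mval a)) s)).
    rewrite (linear_lext (ract_word b)); apply: lext_eq => w _ /=.
    by rewrite !fmM -catA mval_catr // ract_word_cat.
  by rewrite S1_ract // linear0.
have [mb|nb] := boolP (has is_m b).
  transitivity (lact_word a (lext (fun w : {fmonom Y} => lact_word w (mval b)) s)).
    rewrite (linear_lext (lact_word a)); apply: lext_eq => w _ /=.
    by rewrite !fmM mval_catl // lact_word_cat.
  by rewrite S1_lact // linear0.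
move: hm; rewrite (negPf na) (negPf nb) orbF /=.
case/S1P: (Ss) => [[u Lu /(S1_u_lead Lu)[-> _]]|[y [z [myz sE]]] _].
  by rewrite xword_has_m.
transitivity (lact_word a (ract_word b (mvalp s))).
  rewrite /mvalp (linear_lext (ract_word b)) (linear_lext (lact_word a)).
  apply: lext_eq => w /(S1_2_has_m myz sE) mw /=.
  by rewrite !fmM -catA mval_cat.
rewrite sE linearB /= mvalp_mpoly /mvalp lextU subrr.
by rewrite [X in lact_word _ X]linear0 linear0.
Qed.

Lemma has_m_sandwich_S1 (a b w : {fmonom Y}) (s : FA) : S1 s ->
  has is_m (a * lead s * b)%M -> w \in msupp (sandwich a b s) -> has is_m w.
Proof.
move=> Ss hm /msupp_sandwich[v vs ->]; move: hm; rewrite !fmM !has_cat.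
case/S1P: (Ss) => [[u Lu /(S1_u_lead Lu)[-> _]]|[y [z [myz sE]]]].
  by rewrite xword_has_m orbF => /orP[->//|->]; rewrite orbT.
by rewrite (S1_2_has_m myz sE vs) orbT.
Qed.

(** Induction on a bound for the number of letters around [m_j]. Each step shortens the word, so all
    words met stay below [w]. *)
Lemma reduce_m_word n (w a b : {fmonom Y}) j : (size a + size b <= n)%N ->
  (a * mword j * b < w)%M%O ->
  trivial_mod S1 w (<< (a * mword j * b)%M >> - mpoly (mval (a * mword j * b)%M)).
Proof.
elim: n a b j => [|n IH] a b j.
  rewrite leqn0 addn_eq0 => /andP[/eqP/size_fmonom1 -> /eqP/size_fmonom1 ->] _.
  rewrite mul1m mulm1 (_ : mval (mword j) = m j) // mpoly_gen subrr.
  by rewrite trivial_modE; apply: spanned0.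
(* One step replaces two adjacent letters of a word, one of them being
   some [m_i], by a linear combination of letters [m_l]. *)
have step (a' b' : {fmonom Y}) y z : is_m y || is_m z ->
    (size a' + size b' <= n)%N -> (a' * word2 y z * b' < w)%M%O ->
    trivial_mod S1 w (<< (a' * word2 y z * b')%M >> -
                      mpoly (mval (a' * word2 y z * b')%M)).
  move=> myz sz lt; have [s Ss sE] := S1_2_ex myz; set v := mval [:: y; z] in sE *.
  have myz2 : has is_m [:: y; z] by rewrite /= orbF.
  (* After the step the middle factor is a vector [u] of [M]; expanding it in the basis gives words
     with a single middle letter, to which the induction hypothesis applies. *)
  have sandE u : sandwich a' b' (mpoly u) -
      mpoly (lact_word a' (ract_word b' u)) =
      lext (fun l => << (a' * mword l * b')%M >> -
                     mpoly (mval (a' * mword l * b')%M)) (basis_coord m u).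
    have -> : sandwich a' b' (mpoly u) =
        lext (fun l => << (a' * mword l * b')%M >>) (basis_coord m u).
      rewrite /mpoly linear_lext; apply: lext_eq => l _ /=.
      by rewrite sandwichU.
    have -> : mpoly (lact_word a' (ract_word b' u)) =
        lext (fun l => mpoly (mval (a' * mword l * b')%M)) (basis_coord m u).
      rewrite -{1}(basis_coordK m_basis u) (linear_lext (ract_word b')).
      rewrite (linear_lext (lact_word a')) (linear_lext mpoly).
      apply: lext_eq => l _; rewrite !fmM -catA mval_cat //.
    exact/esym/lextB.
  have -> : << (a' * word2 y z * b')%M >> - mpoly (mval (a' * word2 y z * b')%M) =
      sandwich a' b' s + (sandwich a' b' (mpoly v) -
                          mpoly (lact_word a' (ract_word b' v))).
    rewrite sE linearB /= sandwichU addrA subrK; congr (_ - mpoly _).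
    by rewrite !fmM -catA mval_cat.
  rewrite trivial_modE; apply: spannedD.
    apply: (spanned_gen S1_monic) => //.
    by have [-> _] := S1_2_lead sE.
  rewrite sandE; apply: spanned_lext => l _; apply: IH => //.
  exact: lt_trans (deglex_lt_mul a' b' (mword_lt2 l y z)) lt.
(* The step is applied to [m_j] and its left neighbour, or its right one if [a] is empty. *)
case: (lastP (a : seq Y)) (fmK a) => [|s y] aE.
  case: (b : seq Y) (fmK b) => [|y s] bE.
    move=> _; rewrite -aE -bE; apply: IH => //.
  rewrite -aE -bE /= => sz.
  have -> : (FMonom [::] * mword j * FMonom (y :: s))%M =
    (FMonom [::] * word2 (inl j) y * FMonom s)%M :> {fmonom Y}.
    by apply: fmonom_inj; rewrite !fmM.
  exact: step.
rewrite -aE /= size_rcons addSn ltnS => sz.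
have -> : (FMonom (rcons s y) * mword j * b)%M =
    (FMonom s * word2 y (inl j) * b)%M :> {fmonom Y}.
  by apply: fmonom_inj; rewrite !fmM /= cat_rcons -catA.
by apply: step => //; rewrite orbT.
Qed.

Lemma reduce_m_poly (w : {fmonom Y}) (q : P) : below w q ->
  (forall u, u \in msupp q -> has is_m u) ->
  trivial_mod S1 w (q - mpoly (mvalp q)).
Proof.
move=> qw qm.
have -> : q - mpoly (mvalp q) =
    lext (fun v : {fmonom Y} => << v >> - mpoly (mval v)) q.
  rewrite -{1}(lext_id q) /mvalp (linear_lext mpoly); exact/esym/lextB.
rewrite trivial_modE; apply: spanned_lext => u uq.
have /hasP[[j|//] ju _] := qm u uq.
have [a [b uE]] : exists a b : {fmonom Y}, u = (a * mword j * b)%M.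
  case/splitPr: (ju) (fmK u) => a b <-; exists (FMonom a), (FMonom b).
  by apply: fmonom_inj; rewrite !fmM /= -catA.
by rewrite uE; apply: (reduce_m_word (leqnn _)); rewrite -uE; apply: qw.
Qed.

Lemma composition_has_m (s t : FA) w p : S1 s -> S1 t ->
  is_composition s t w p -> has is_m w -> trivial_mod S1 w p.
Proof.
move=> Ss St /is_composition_sandwich[a [b [b' [pE ws wt _]]]] hw.
have p0 : mvalp p = 0.
  by rewrite pE linearB /= !mvalp_sandwich_S1 ?subr0 // -?ws -?wt.
have pm u : u \in msupp p -> has is_m u.
  rewrite pE => /(fsubsetP (msuppB_le _ _)); rewrite in_fsetU => /orP[|].
    by apply: has_m_sandwich_S1 => //; rewrite -ws.
  by apply: has_m_sandwich_S1 => //; rewrite -wt.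
(* Both multiples are monic with leading word [w], which cancels in the difference. *)
have pw : below w p.
  have -> : p = (sandwich 1%M b s - << w >>) - (sandwich a b' t - << w >>).
    by rewrite pE opprB addrA subrK.
  apply: belowB; [rewrite ws|rewrite wt]; rewrite -sandwichU -linearB /=;
    exact/below_sandwich/lead_below/S1_monic.
by have := reduce_m_poly pw pm; rewrite p0 linear0 subr0.
Qed.

(** * Compositions over X and the elements g *)

Lemma mvalp_sandwich_mpoly (a b : {fmonom X}) v :
  mvalp (sandwich (xword a) (xword b) (mpoly v)) = wract ract (wlact lact a v) b.
Proof.
rewrite -{2}(fmK b) -ract_word_inr -{2}(fmK a) -lact_word_inr lract_word.
rewrite -{2}(basis_coordK m_basis v) (linear_lext (ract_word _)).
rewrite (linear_lext (lact_word _)) /mpoly (linear_lext (sandwich _ _)).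
rewrite (linear_lext mvalp); apply: lext_eq => j _ /=.
by rewrite sandwichU /mvalp lextU !fmM -catA mval_cat.
Qed.

Lemma sandwich_mpoly_has_m (a b w : {fmonom Y}) v :
  w \in msupp (sandwich a b (mpoly v)) -> has is_m w.
Proof.
by case/msupp_sandwich => _ /mpoly_has_m[j ->] ->; rewrite !fmM !has_cat orbT.
Qed.

(** The hypothesis is not strict because for [(u1) c] and [d (u2)] the word [a u b] is [w] itself;
    putting some [m_j] in place of [u] already lowers it strictly. *)
Lemma sandwich_mpoly_below (a b u w : {fmonom X}) v : u != 1%M ->
  (a * u * b <= w)%M%O ->
  below (xword w) (sandwich (xword a) (xword b) (mpoly v)).
Proof.
move=> u1 le; apply: (@below_trans _ _ _ (xword (a * u * b)%M)).
  by move: le; rewrite le_eqVlt => /orP[/eqP ->|/xword_lt /ltW].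
rewrite !xwordM; apply/below_sandwich/mpoly_below => j.
exact: mword_xword.
Qed.

(* The composition in [S1] lying over the composition [(h_u1, h_u2)_w] in [R]
   reduces to [g_(u1, u2)_w]. *)
Lemma composition_g (s1 s2 : FA) u1 u2 c d e :
  (s1 : P) = xpoly (hrel f u1) - mpoly (mu u1) ->
  (s2 : P) = xpoly (hrel f u2) - mpoly (mu u2) ->
  R_composition Lambda u1 u2 c d -> expression_of Lambda f u1 u2 c d e ->
  trivial_mod S1 (xword (u1 * c)%M)
    (sandwich 1%M (xword c) s1 - sandwich (xword d) 1%M s2
     - mpoly (g_elt lact ract mu u1 u2 c d e)).
Proof.
move=> s1E s2E [L1 L2 c1 d1 [ucE _]] [eL eE].
set w := xword (u1 * c)%M; set g := g_elt _ _ _ _ _ _ _ _.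
(* [q] collects the terms with letters [m_j] left over when every [h_u'] of the expression is
   completed to a relation of [S_1]; its value is [g]. *)
pose q := \sum_(i < esize e) ecoef e i *:
    sandwich (xword (eleft e i)) (xword (eright e i)) (mpoly (mu (eword e i)))
  - (sandwich (xword 1%M) (xword c) (mpoly (mu u1))
     - sandwich (xword d) (xword 1%M) (mpoly (mu u2))).
have x1 : xword 1%M = 1%M by apply: fmonom_inj; rewrite /= !fm1.
have pE : sandwich 1%M (xword c) s1 - sandwich (xword d) 1%M s2 =
    \sum_(i < esize e) ecoef e i *:
      sandwich (xword (eleft e i)) (xword (eright e i))
        (xpoly (hrel f (eword e i)) - mpoly (mu (eword e i))) + q.
  have -> : \sum_(i < esize e) ecoef e i *:
      sandwich (xword (eleft e i)) (xword (eright e i))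
        (xpoly (hrel f (eword e i)) - mpoly (mu (eword e i))) + q =
      xpoly (sandwich 1%M c (hrel f u1) - sandwich d 1%M (hrel f u2))
      - (sandwich (xword 1%M) (xword c) (mpoly (mu u1))
         - sandwich (xword d) (xword 1%M) (mpoly (mu u2))).
    rewrite /q addrA -big_split /=; congr (_ - _).
    (* Since [u1 c = d u2], the leading terms of [h_u1 c - d h_u2] cancel, leaving
       [d f_u2 - f_u1 c], which [e] expresses. *)
    have -> : sandwich 1%M c (hrel f u1) - sandwich d 1%M (hrel f u2) =
        \sum_(i < esize e) ecoef e i *:
          sandwich (eleft e i) (eright e i) (hrel f (eword e i)).
      under eq_bigr do rewrite sandwichM.
      rewrite -eE.
      have -> : sandwich 1%M c (hrel f u1) =
          << (d * u2)%M >> - (f u1 : {malg _[_]}) * << c >>.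
        rewrite -ucE -sandwichr -(mul1m (u1 * c)%M) mulmA -sandwichU.
        by rewrite -(word_val k (Lambda_nonempty L1)) -linearB.
      have -> : sandwich d 1%M (hrel f u2) = << (d * u2)%M >> - << d >> * f u2.
        rewrite -sandwichl -(mulm1 (d * u2)%M) -sandwichU.
        by rewrite -(word_val k (Lambda_nonempty L2)) -linearB.
      by rewrite opprB addrC addrA subrK.
    rewrite linear_sum; apply: eq_bigr => i _.
    rewrite linearZ /= xpoly_sandwich -scalerDr; congr (_ *: _).
    by rewrite -linearD subrK.
  rewrite (linearB xpoly) /= !xpoly_sandwich x1 s1E s2E.
  rewrite (linearB (sandwich 1%M _)) (linearB (sandwich (xword d) _)) /=.
  by rewrite [in LHS]opprD addrACA -opprD.
have qw : below w q.
  apply: belowB.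
    apply: (big_ind (below w)); [exact: below0|exact: belowD|] => i _.
    have [Lu lt] := eL i; apply/belowZ.
    exact: sandwich_mpoly_below (Lambda_nonempty Lu) (ltW lt).
  apply: belowB.
    apply: (@sandwich_mpoly_below 1%M c u1 (u1 * c)%M _ (Lambda_nonempty L1)).
    by rewrite mul1m.
  apply: (@sandwich_mpoly_below d 1%M u2 (u1 * c)%M _ (Lambda_nonempty L2)).
  by rewrite mulm1 ucE.
have qm u : u \in msupp q -> has is_m u.
  rewrite /q => /(fsubsetP (msuppB_le _ _)); rewrite in_fsetU => /orP[|].
    rewrite -mcoeff_neq0 raddf_sum /= => H; apply: contraNT H => nu.
    rewrite big1 // => i _; rewrite mcoeffZ; apply/eqP; rewrite mulf_eq0.
    rewrite mcoeff_eq0; apply/orP; right; apply: contra nu.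
    exact: sandwich_mpoly_has_m.
  move=> /(fsubsetP (msuppB_le _ _)); rewrite in_fsetU => /orP[|];
    exact: sandwich_mpoly_has_m.
have qg : mvalp q = g.
  rewrite /q 2!(linearB mvalp) /= linear_sum !mvalp_sandwich_mpoly /g /g_elt.
  congr (_ - (_ - _)).
  - by apply: eq_bigr => i _; rewrite linearZ /= mvalp_sandwich_mpoly.
  - by rewrite /wlact eqxx.
  - by rewrite /wract eqxx.
rewrite pE -addrA -qg trivial_modE; apply: spannedD; last first.
  by rewrite -trivial_modE; apply: reduce_m_poly.
apply: spanned_sum => i; have [Lu lt] := eL i.
have [s Ss sE] := S1_u_ex Lu; rewrite -sE; apply: (spanned_gen S1_monic) => //.
by have [-> _] := S1_u_lead Lu sE; rewrite -!xwordM; apply: xword_lt.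
Qed.

(** * The criterion for S_1 to be a Groebner-Shirshov basis *)

Lemma S1_no_m (s : FA) : S1 s -> ~~ has is_m (lead s) ->
  exists2 u, Lambda u & (s : P) = xpoly (hrel f u) - mpoly (mu u).
Proof.
case/S1P=> [//|[y [z [myz /S1_2_lead[-> _]]]]].
by rewrite /= orbF myz.
Qed.

Hypothesis R_minimal : GS_minimal (R_rel Lambda f).

(** Minimality compares polynomials: nested leading words force [h_u1 = h_u2], hence [u1 = u2], and
    counting letters empties [a] and [b]. *)
Lemma Lambda_infix u1 u2 (a b : {fmonom X}) : Lambda u1 -> Lambda u2 ->
  u1 = (a * u2 * b)%M -> [/\ u1 = u2, a = 1%M & b = 1%M].
Proof.
move=> L1 L2 e; have u12 : u1 = u2.
  rewrite -(Lambda_lead L1) -(Lambda_lead L2); congr (lead _).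
  apply: contrapT => ne; have := R_minimal (f := hrel f u2) (g := hrel f u1).
  move=> /(_ _ _ _)/negP; apply; [by exists u2|by exists u1| |].
    by move=> h; apply: ne; rewrite h.
  by rewrite !Lambda_lead // e !fmM -catA; apply/infixP; exists a, b.
move/(congr1 (fun w : {fmonom X} => size w)): e.
rewrite u12 !fmM !size_cat => /eqP; rewrite -addnA addnCA -{1}[size u2]addn0.
rewrite eqn_add2l eq_sym addn_eq0 => /andP[/eqP a0 /eqP b0].
by split=> //; apply: size_fmonom1.
Qed.

Variable E : {fmonom X} -> {fmonom X} -> {fmonom X} -> {fmonom X} ->
  expression k X.
Hypothesis E_expr : forall u1 u2 c d, R_composition Lambda u1 u2 c d ->
  expression_of Lambda f u1 u2 c d (E u1 u2 c d).

Lemma S1_GS_suff : (forall u1 u2 c d, R_composition Lambda u1 u2 c d ->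
    g_elt lact ract mu u1 u2 c d (E u1 u2 c d) = 0) -> GS_basis S1.
Proof.
move=> g0; split=> [s|s t w p Ss St comp]; first exact: S1_monic.
have [mw|nw] := boolP (has is_m w); first exact: composition_has_m comp mw.
have [a [b [b' [pE ws wt cases]]]] := is_composition_sandwich comp.
have /andP[/andP[_ ns] nb] :
    [&& ~~ has is_m (1%M : {fmonom Y}) && ~~ has is_m (lead s) & ~~ has is_m b].
  by move: nw; rewrite ws !fmM !has_cat !negb_or.
have /andP[/andP[na nt] nb'] :
    [&& ~~ has is_m a && ~~ has is_m (lead t) & ~~ has is_m b'].
  by move: nw; rewrite wt !fmM !has_cat !negb_or.
have [u1 L1 sE] := S1_no_m Ss ns; have [u2 L2 tE] := S1_no_m St nt.
have [lu1 _] := S1_u_lead L1 sE; have [lu2 _] := S1_u_lead L2 tE.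
have [a1 aE] := no_m_xword na; have [b1 bE] := no_m_xword nb.
have [b2 b'E] := no_m_xword nb'.
have x1 : xword 1%M = 1%M by apply: fmonom_inj; rewrite /= !fm1.
have x1_inj u : xword u = 1%M -> u = 1%M.
  by rewrite -x1 => /xword_inj.
have ue : (1 * u1 * b1)%M = (a1 * u2 * b2)%M.
  by apply: xword_inj; rewrite !xwordM x1 -lu1 -lu2 -aE -bE -b'E -ws.
(* [R_composition] asks for nonempty [c] and [d]; the remaining compositions have nested leading
   words and reduce to this case, where [p = 0]. *)
have equal : u1 = u2 -> a1 = 1%M -> b1 = 1%M -> b2 = 1%M ->
    trivial_mod S1 w p.
  move=> u12 a11 b11 b21; rewrite pE aE bE b'E a11 b11 b21 x1 !sandwich1.
  by rewrite sE tE u12 subrr trivial_modE; apply: spanned0.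
have [b11|b1n] := eqVneq b1 1%M.
  have e1 : u1 = (a1 * u2 * b2)%M by rewrite -ue b11 mulm1 mul1m.
  by have [u12 a11 b21] := Lambda_infix L1 L2 e1; apply: equal.
case: cases => [b0|[b'1 sz]].
  by move: b1n; rewrite (x1_inj b1) ?eqxx // -bE.
have b21 : b2 = 1%M by apply: x1_inj; rewrite -b'E.
have [a11|a1n] := eqVneq a1 1%M.
  have e2 : u2 = (1 * u1 * b1)%M by rewrite ue a11 b21 mul1m mulm1.
  by have [u21 _ b11] := Lambda_infix L2 L1 e2; apply: equal.
rewrite mul1m b21 mulm1 in ue.
have RC : R_composition Lambda u1 u2 b1 a1.
  split=> //; split=> //.
  by move: sz; rewrite ws mul1m lu1 lu2 bE -xwordM /= !size_map.
have := composition_g sE tE RC (E_expr RC).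
rewrite pE (g0 _ _ _ _ RC) linear0 subr0 -{1}(mul1m u1) !xwordM.
by rewrite -aE -bE x1 b'1 -lu1 -ws.
Qed.

Hypothesis X_wo : well_order (<=%O : rel X).
Hypothesis J_wo : well_order (<=%O : rel J).

(** A nonzero [mpoly v] has a single letter [m_j] as leading word. The leading words of [S_1] are
    nonempty words over [X] or have length two, so none occurs in it. *)
Lemma mpoly_spanned v : GS_basis S1 ->
  spanned S1 (fun _ => True) (mpoly v) -> v = 0.
Proof.
move=> GS sp; rewrite -(mvalp_mpoly v); have [->|nz] := eqVneq (mpoly v) 0.
  exact: linear0.
have [s [a [b [Ss]]]] :=
  composition_diamond GS (sum_well_order J_wo X_wo) sp nz.
have [j ->] := mpoly_has_m (lead_neq0 nz).
(* Length and presence of some [m_j] are the only invariants needed to exclude the factorisation. *)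
move=> /(congr1 (fun w : {fmonom Y} => (size w, has is_m w))).
rewrite !fmM !size_cat !has_cat /= => -[].
case/S1P: Ss => [[u Lu /(S1_u_lead Lu)[-> _]]|[y [z [_ /S1_2_lead[-> _]]]]] /=.
  rewrite xword_has_m size_map orbF.
  have : (0 < size u)%N.
    by rewrite lt0n; apply: contraNneq (Lambda_nonempty Lu) => /size_fmonom1 ->.
  case: (size u) => // n _; rewrite addnS addSn => -[].
  move/eqP; rewrite eq_sym !addn_eq0 => /andP[/andP[/eqP a0 _] /eqP b0].
  by rewrite (size0nil a0) (size0nil b0).
by move/eqP; rewrite addnS addnS !addSn.
Qed.

(** The composition over [(h_u1, h_u2)_w] is trivial by assumption and also reduces to [mpoly g];
    subtracting puts [mpoly g] in the span of [S1]. *)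
Lemma S1_GS_necessary u1 u2 c d : GS_basis S1 -> R_composition Lambda u1 u2 c d ->
  g_elt lact ract mu u1 u2 c d (E u1 u2 c d) = 0.
Proof.
move=> GS RC; apply: mpoly_spanned => //.
case: (RC) => L1 L2 _ _ [ue sz].
have [s Ss sE] := S1_u_ex L1; have [t St tE] := S1_u_ex L2.
have [ls _] := S1_u_lead L1 sE; have [lt _] := S1_u_lead L2 tE.
have cg := composition_g sE tE RC (E_expr RC).
have ct : trivial_mod S1 (xword (u1 * c)%M)
    (sandwich 1%M (xword c) s - sandwich (xword d) 1%M t).
  rewrite sandwichr sandwichl; apply: GS.2 Ss St _; apply: Intersection.
  - by rewrite ls xwordM.
  - by rewrite lt -xwordM ue.
  - by rewrite ls lt /= !size_map.
rewrite trivial_modE in cg; rewrite trivial_modE in ct.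
have := spannedB ct cg; rewrite opprB addrC subrK.
exact: spannedW.
Qed.

(** * M as an ideal of square zero in A *)

Lemma basis_ind (F : M -> Prop) : F 0 ->
  (forall u v, F u -> F v -> F (u + v)) -> (forall c v, F v -> F (c *: v)) ->
  (forall j, F (m j)) -> forall v, F v.
Proof.
move=> F0 FD FZ Fm v; rewrite -(basis_coordK m_basis v).
by apply: (big_ind F) => // j _; apply/FZ/Fm.
Qed.

(** The multiples [a s b] with possibly empty [a], [b] span an ideal containing [S1]; closure under
    products is checked on words. *)
Lemma ideal_gen_spanned (x : FA) :
  ideal_gen S1 x -> spanned S1 (fun _ => True) x.
Proof.
move=> /(_ [set z : FA | spanned S1 (fun _ => True) z]); apply => /=; last first.
  move=> s Ss /=; rewrite -(sandwich1 s).
  by apply: (spanned_gen S1_monic).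
split.
- exact: spanned0.
- by move=> y z; apply: spannedD.
- by move=> a y; apply: spannedZ.
- move=> y z sz; pose F (y' : FA) := spanned S1 (fun _ => True) (y' ** z : FA).
  apply: (freenu_ind (F := F)) => [|p q sp sq|a p sp|w w1]; rewrite /F.
  + by rewrite numul0l; apply: spanned0.
  + by rewrite numulDl; exact: (spannedD sp sq).
  + by rewrite numulZl; exact: (spannedZ a sp).
  rewrite freenuM (word_val k w1) -sandwichl.
  exact: (spanned_sandwich S1_monic (Q := fun _ => True)) sz.
move=> z y sz; pose F (y' : FA) := spanned S1 (fun _ => True) (z ** y' : FA).
apply: (freenu_ind (F := F)) => [|p q sp sq|a p sp|w w1]; rewrite /F.
+ by rewrite numul0r; apply: spanned0.
+ by rewrite numulDr; exact: (spannedD sp sq).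
+ by rewrite numulZr; exact: (spannedZ a sp).
rewrite freenuM (word_val k w1) -sandwichr.
exact: (spanned_sandwich S1_monic (Q := fun _ => True)) sz.
Qed.

Lemma freenu_map_inr (p : freenu k X) :
  freenu_map inr p = free_hom (x_letter k J) p.
Proof.
apply: lext_eq => w wp.
have : (w : seq X) != [::].
  by rewrite -fm1 -fmP; apply: contraNneq (freenu_msupp1 p) => <-.
case: w {wp} => /= s; elim: s => // x [_ _|y s IH _].
  by rewrite /= /x_letter /letter fmuE.
rewrite map_cons fmonom_consE wordM ?fmu_neq1 ?FMonom_eq1 // IH //.
by rewrite -(word_eval_cat _ (s := [:: x])).
Qed.

Local Notation clB := (nuclass (R_rel Lambda f)).
Local Notation clA := (nuclass S1).
Local Notation A := (algA lact ract m mu).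

Definition ext_incl v : A := clA (m_poly X m v).

Fact ext_incl_linear : linear ext_incl.
Proof.
move=> c u v; rewrite /ext_incl /m_poly -!/(lext _ _).
by rewrite (basis_coord_linear m_basis) !linearP.
Qed.

HB.instance Definition _ :=
  GRing.isLinear.Build k M A *:%R ext_incl ext_incl_linear.

Lemma ext_incl_gen j : ext_incl (m j) = clA (m_letter k X j).
Proof. by rewrite /ext_incl /m_poly -/(lext _ _) basis_coord_gen // lextU. Qed.

Lemma ext_incl_inj : GS_basis S1 -> injective ext_incl.
Proof.
move=> GS u v /nuclass_eq /ideal_gen_spanned.
rewrite linearB /= !m_poly_val -linearB => /(mpoly_spanned GS).
exact: subr0_eq.
Qed.

Lemma ext_incl_letterl y v :
  exists v', clA (letter k y) ** ext_incl v = ext_incl v'.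
Proof.
move: v; apply: basis_ind.
- by exists 0; rewrite linear0 numul0r.
- move=> u v [u' uE] [v' vE]; exists (u' + v').
  by rewrite !linearD /= numulDr uE vE.
- by move=> c v [v' vE]; exists (c *: v'); rewrite !linearZ /= numulZr vE.
move=> j; rewrite ext_incl_gen -nuclassME.
case: y => [l|x]; last first.
  exists (lact (clB (letter k x)) (m j)); apply/nuclass_eq => I _; apply.
  by constructor 2; exists x, j.
exists 0; rewrite linear0; apply: nuclass_rel.
by constructor 4; exists l, j.
Qed.

Lemma ext_incl_letterr y v :
  exists v', ext_incl v ** clA (letter k y) = ext_incl v'.
Proof.
move: v; apply: basis_ind.
- by exists 0; rewrite linear0 numul0l.
- move=> u v [u' uE] [v' vE]; exists (u' + v').
  by rewrite !linearD /= numulDl uE vE.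
- by move=> c v [v' vE]; exists (c *: v'); rewrite !linearZ /= numulZl vE.
move=> j; rewrite ext_incl_gen -nuclassME.
case: y => [l|x]; last first.
  exists (ract (m j) (clB (letter k x))); apply/nuclass_eq => I _; apply.
  by constructor 3; exists j, x.
exists 0; rewrite linear0; apply: nuclass_rel.
by constructor 4; exists j, l.
Qed.

Lemma ext_incl_ideal : is_ideal (range ext_incl).
Proof.
split.
- by exists 0 => //; apply: linear0.
- by move=> _ _ [u _ <-] [v _ <-]; exists (u + v) => //; apply: linearD.
- by move=> a _ [v _ <-]; exists (a *: v) => //; apply: linearZ.
- move=> x _ [v _ <-]; rewrite -(nureprK x); move: (nurepr x) v.
  apply: freenu_letter_ind.
  + by move=> v; exists 0 => //; rewrite !linear0 numul0l.
  + move=> p q Hp Hq v; have [u _ uE] := Hp v; have [u' _ u'E] := Hq v.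
    by exists (u + u') => //; rewrite !linearD /= uE u'E numulDl.
  + move=> a p Hp v; have [u _ uE] := Hp v.
    by exists (a *: u) => //; rewrite !linearZ /= uE numulZl.
  + by move=> y v; have [v' ->] := ext_incl_letterl y v; exists v'.
  move=> p q Hp Hq v; have [u _ uE] := Hq v; have [u' _ u'E] := Hp u.
  by exists u' => //; rewrite nuclassME -numulA -uE.
move=> _ x [v _ <-]; rewrite -(nureprK x); move: (nurepr x) v.
apply: freenu_letter_ind.
+ by move=> v; exists 0 => //; rewrite !linear0 numul0r.
+ move=> p q Hp Hq v; have [u _ uE] := Hp v; have [u' _ u'E] := Hq v.
  by exists (u + u') => //; rewrite !linearD /= uE u'E numulDr.
+ move=> a p Hp v; have [u _ uE] := Hp v.
  by exists (a *: u) => //; rewrite !linearZ /= uE numulZr.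
+ by move=> y v; have [v' ->] := ext_incl_letterr y v; exists v'.
move=> p q Hp Hq v; have [u _ uE] := Hp v; have [u' _ u'E] := Hq u.
by exists u' => //; rewrite nuclassME numulA -uE.
Qed.

Lemma ext_incl_sqr0 u v : ext_incl u ** ext_incl v = 0.
Proof.
move: u; apply: basis_ind => [|u u' Hu Hu'|c u Hu|j].
- by rewrite linear0 numul0l.
- by rewrite linearD /= numulDl Hu Hu' addr0.
- by rewrite linearZ /= numulZl Hu scaler0.
move: v; apply: basis_ind => [|v v' Hv Hv'|c v Hv|l].
- by rewrite linear0 numul0r.
- by rewrite linearD /= numulDr Hv Hv' addr0.
- by rewrite linearZ /= numulZr Hv scaler0.
rewrite !ext_incl_gen -nuclassME; apply: nuclass_rel.
by constructor 4; exists j, l.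
Qed.

(** * The isomorphism of B with A/M *)

Section QuotientIso.
Variable iota : {linear M -> A}.
Hypothesis iotaE : iota =1 ext_incl.

Local Notation clI := (nuclass (range iota)).
Local Notation xhom := (free_hom (x_letter k J)).

(** Maps in both directions come from the universal properties of the free algebras and their
    quotients; they are mutually inverse because homomorphisms from a free algebra are determined on
    letters. *)
Lemma quotient_iso : exists phi : {linear algB Lambda f -> nuquot (range iota)},
  [/\ forall p q, phi (p ** q) = phi p ** phi q, bijective phi &
      forall x, phi (clB (letter k x)) = clI (clA (x_letter k J x))].
Proof.
have iota0 v : clI (iota v) = 0 by apply: nuclass_rel; exists v.
have uE u : Lambda u -> word k (FMonom (map inr u)) = xhom (word k u).
  move=> Lu; rewrite -freenu_map_inr /freenu_map.
  by rewrite (word_val k (Lambda_nonempty Lu)) -/(lext _ _) lextU.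
have [phi [phiM phiE]] : exists phi : {linear algB Lambda f -> nuquot (range iota)},
    (forall p q, phi (p ** q) = phi p ** phi q) /\
    (forall x, phi (clB x) = clI (clA (xhom x))).
  apply: (@nuquot_lift _ _ _ _ (clI \o (clA \o xhom))).
    by move=> x y /=; rewrite free_homM !nuclassME.
  (* In [A] the image of [h_u] is [(u)], which lies in the range of [iota]. *)
  move=> _ [u Lu <-] /=; rewrite -(iota0 (mu u)) iotaE; congr (clI _).
  apply/nuclass_eq => I _; apply; constructor 1; exists u => //.
  by rewrite linearB /= -(uE u Lu) -freenu_map_inr opprD addrA.
(* The inverse sends every [m_j] to 0, so the relation of [u] in [S_1] is mapped to the class of
   [h_u] in [B]. *)
pose h (y : Y) : algB Lambda f := if y is inr x then clB (letter k x) else 0.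
have hm v : free_hom h (m_poly X m v) = 0.
  rewrite /m_poly -/(lext _ _) linear_lext /lext big1 // => j _ /=.
  by rewrite free_hom_letter scaler0.
have hx p : free_hom h (xhom p) = clB p.
  apply: (freenu_hom_eq (F := free_hom h \o xhom) (G := clB)) => [q r|q r|x] /=.
  - by rewrite !free_homM.
  - exact: nuclassME.
  by rewrite free_hom_letter free_hom_letter.
have [psi1 [psi1M psi1E]] : exists psi1 : {linear A -> algB Lambda f},
    (forall p q, psi1 (p ** q) = psi1 p ** psi1 q) /\
    (forall x, psi1 (clA x) = free_hom h x).
  apply: nuquot_lift; first exact: free_homM.
  move=> _ [[u Lu ->]|[x [j ->]]|[j [x ->]]|[j [l ->]]].
  - rewrite linearB (linearD (free_hom h)) /= hm addr0 uE // freenu_map_inr !hx.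
    rewrite -linearB.
    by apply: nuclass_rel; exists u.
  - by rewrite linearB /= hm subr0 free_homM [X in _ ** X]free_hom_letter numul0r.
  - by rewrite linearB /= hm subr0 free_homM [X in X ** _]free_hom_letter numul0l.
  - rewrite -[LHS]/(free_hom h _) free_homM [X in _ ** X]free_hom_letter.
    exact: numul0r.
have [psi [psiM psiE]] : exists psi : {linear nuquot (range iota) -> algB Lambda f},
    (forall p q, psi (p ** q) = psi p ** psi q) /\
    (forall x, psi (clI x) = psi1 x).
  apply: nuquot_lift => // _ [v _ <-].
  by rewrite iotaE psi1E hm.
exists phi; split=> //; last by move=> x; rewrite phiE free_hom_letter.
exists psi => [p|q].
  by rewrite -(nureprK p) phiE psiE psi1E hx.
rewrite -(nureprK q) psiE -(nureprK (nurepr q)) psi1E.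
apply: (freenu_hom_eq (F := phi \o free_hom h)
  (G := clI \o clA)) => [p p'|p p'|y] /=.
- by rewrite free_homM phiM.
- by rewrite !nuclassME.
rewrite free_hom_letter; case: y => [j|x] /=.
  by rewrite linear0 -ext_incl_gen -iotaE iota0.
by rewrite phiE free_hom_letter.
Qed.

End QuotientIso.

End ExtensionTheory.

Theorem theorem2p4 (k : fieldType) (dX dJ : Order.disp_t)
    (X : orderType dX) (J : orderType dJ)
    (X_wo : well_order (<=%O : rel X)) (J_wo : well_order (<=%O : rel J))
    (Lambda : set {fmonom X}) (f : {fmonom X} -> freenu k X)
    (Lambda_nonempty : forall u, Lambda u -> u != 1%M)
    (Lambda_lead : forall u, Lambda u -> lead (hrel f u) = u)
    (R_GS : GS_basis (R_rel Lambda f)) (R_minimal : GS_minimal (R_rel Lambda f))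
    (M : lmodType k)
    (lact : algB Lambda f -> M -> M) (ract : M -> algB Lambda f -> M)
    (M_bimodule : is_bimodule lact ract)
    (m : J -> M) (m_basis : is_basis m)
    (mu : {fmonom X} -> M)
    (E : {fmonom X} -> {fmonom X} -> {fmonom X} -> {fmonom X} ->
         expression k X)
    (E_expr : forall u1 u2 c d, R_composition Lambda u1 u2 c d ->
       expression_of Lambda f u1 u2 c d (E u1 u2 c d)) :
  (GS_basis (S1_rel lact ract m mu) <->
   (forall u1 u2 c d, R_composition Lambda u1 u2 c d ->
      g_elt lact ract mu u1 u2 c d (E u1 u2 c d) = 0))
  /\
  (GS_basis (S1_rel lact ract m mu) ->
   exists iota : {linear M -> algA lact ract m mu},
     [/\ forall j, iota (m j) = nuclass (S1_rel lact ract m mu) (m_letter k X j),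
         injective iota,
         is_ideal (range iota),
         forall v v', iota v ** iota v' = 0 &
         exists phi : {linear algB Lambda f -> nuquot (range iota)},
           [/\ forall b b', phi (b ** b') = phi b ** phi b',
               bijective phi &
               forall x, phi (nuclass (R_rel Lambda f) (letter k x)) =
                 nuclass (range iota)
                   (nuclass (S1_rel lact ract m mu) (x_letter k J x))]]).
Proof.
split; first split.
- move=> GS u1 u2 c d.
  exact: (S1_GS_necessary M_bimodule Lambda_nonempty Lambda_lead R_GS m_basis
    E_expr X_wo J_wo GS).
- exact: (S1_GS_suff M_bimodule Lambda_nonempty Lambda_lead R_GS m_basis
    R_minimal E_expr).
move=> GS.
have [iota iotaE] := linear_existence (ext_incl_linear lact ract m_basis mu).
have rangeE : range iota = range (ext_incl lact ract m mu).
  by congr (_ @` _); apply: functional_extensionality_dep.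
exists iota; split.
- by move=> j; rewrite iotaE ext_incl_gen.
- move=> u v; rewrite !iotaE.
  exact: (ext_incl_inj Lambda_nonempty Lambda_lead R_GS m_basis
    X_wo J_wo GS).
- by rewrite rangeE; apply: ext_incl_ideal.
- by move=> u v; rewrite !iotaE; apply: ext_incl_sqr0.
exact: (quotient_iso Lambda_nonempty m_basis iotaE).
Qed.
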